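(* Let $r\ge3$ be an integer and let $c,K$ be positive reals with $c<\frac{3}{2r}$. For every small enough $\epsilon>0$ and every sufficiently large integer $n$ the following holds. For every $p$ with $n^{-c}\le p\le\frac12$ and every $t$ with $n^{\epsilon}\le t\le n^{1/2+\epsilon}p$, $$\left|\mathbb{E}\left[e^{it\cdot X_r/\sigma_r}\right]\right|\le t^{-K}.$$
   Context: $G_{n,p}$ is the binomial random graph on $[n]$ with edge probability $p$. $X_r$ is the number of copies of $K_r$ in $G_{n,p}$ (the number of $r$-element vertex subsets inducing a clique), and $\sigma_r$ is its standard deviation. *)

(* Defs.v *)
From HB Require Import structures.
From mathcomp Require Import all_boot all_order all_algebra.
From mathcomp Require Import complex.
From mathcomp Require Import reals exp trigo.

Set Implicit Arguments.
Unset Strict Implicit.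
Unset Printing Implicit Defensive.

Import Order.TTheory GRing.Theory Num.Theory.
Local Open Scope ring_scope.

Definition potential_edges (n : nat) : {set {set 'I_n}} :=
  [set e : {set 'I_n} | #|e| == 2%N].

(* A graph on 'I_n is identified with its set of edges, each edge being a
   2-element set of vertices. *)
Definition graphs (n : nat) : {set {set {set 'I_n}}} :=
  powerset (potential_edges n).

Definition gnp_prob (R : realType) (n : nat) (p : R)
    (G : {set {set 'I_n}}) : R :=
  \prod_(e in potential_edges n) (if e \in G then p else 1 - p).

(* The target is an arbitrary real vector space, so that the same expectation
   serves for real-valued (V := R^o) and complex-valued (V := Rcomplex R)
   random variables. *)
Definition gnp_expectation (R : realType) (V : lmodType R) (n : nat) (p : R)
    (f : {set {set 'I_n}} -> V) : V :=
  \sum_(G in graphs n) gnp_prob p G *: f G.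

Definition is_clique (n : nat) (G : {set {set 'I_n}}) (A : {set 'I_n}) : bool :=
  [forall x in A, forall y in A, (x != y) ==> ([set x; y] \in G)].

Definition clique_count (n r : nat) (G : {set {set 'I_n}}) : nat :=
  #|[set A : {set 'I_n} | (#|A| == r) && is_clique G A]|.

Definition clique_mean (R : realType) (n r : nat) (p : R) : R :=
  gnp_expectation p (fun G : {set {set 'I_n}} => (clique_count r G)%:R : R^o).

Definition clique_variance (R : realType) (n r : nat) (p : R) : R :=
  gnp_expectation p (fun G : {set {set 'I_n}} =>
    ((clique_count r G)%:R - clique_mean n r p) ^+ 2 : R^o).

Definition clique_sd (R : realType) (n r : nat) (p : R) : R :=
  Num.sqrt (clique_variance n r p).

(* e^{i x} for real x, by Euler's formula. The carrier Rcomplex R is R[i] seen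
   as a real normed vector space: its norm is the usual modulus, but takes its
   values in R instead of R[i]. *)
Definition expi (R : realType) (x : R) : Rcomplex R :=
  Complex (cos x) (sin x).

Definition clique_charfun (R : realType) (n r : nat) (p t : R) : Rcomplex R :=
  gnp_expectation p (fun G : {set {set 'I_n}} =>
    expi (t * (clique_count r G)%:R / clique_sd n r p)).

(* Main.v *)
Require Import Defs.
From mathcomp Require Import all_boot all_order all_algebra.
From mathcomp Require Import complex.
From mathcomp Require Import reals exp trigo.
From mathcomp Require topology normedtype derive.
From mathcomp Require Import sequences.
From mathcomp Require Import zify ring lra.
Import Order.TTheory GRing.Theory Num.Theory.
Local Open Scope ring_scope.

Set Implicit Arguments.
Unset Strict Implicit.
Unset Printing Implicit Defensive.

(** Write s = t / sigma_r, so that the claim is a bound on E[exp(i s X)] for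
    the number X of r-cliques. Choose a set B of about n^(1 + eps/2) / t
    vertices and condition on all edges that do not lie inside B. What is left
    of X is a polynomial in the independent edges inside B. Its best linear
    approximation is a sum over these edges e of a coefficient d_e times the
    indicator of e; call the remainder Q.

    The linear part alone gives the decay. Its conditional characteristic
    function is a product of one factor per edge of B, and each factor has
    modulus at most exp(- p (s d_e)^2 / 8). Since d_e is close to its mean, of
    order n^(r - 2) p^(C(r,2) - 1), while sigma_r is of order
    n^(r - 1) p^(C(r,2) - 1/2), the exponents add up to about
    (t |B| / n)^2 = n^eps, which beats every power of n. The upper bound on t
    is what keeps the phases s d_e below 1, where this estimate is valid.

    The remainder Q is removed by expanding exp(i s Q) to an even order L.
    Every monomial of Q^j involves a bounded number of edges of B; given those,
    the other edges of B are still independent and produce the same decay. The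
    Taylor error is at most 2 E[(s Q)^L]. An event on which some d_e is far
    from its mean is paid for by the L-th moment of d_e - E d_e.

    So everything rests on high moments of three sums over cliques: Q, the
    centred coefficients d_e, and X - E X (with L = 2, for the size of
    sigma_r). All three come from one estimate, [moment_bound]. The L-th moment
    expands over L-tuples of cliques, and a tuple contributes nothing unless
    every clique overlaps the union of the others: in 2 vertices for X - E X,
    in 3 vertices including those of e for d_e, in 3 vertices of B for Q.
    Revealing the cliques one at a time, a clique A that meets the earlier ones
    in a vertices costs n^r p^C(r,2) / (n^a p^C(a,2)). The order of revelation
    and its reverse are both available, and between them the two overlaps of A
    cover the whole overlap; the geometric mean of the two bounds therefore
    charges every clique for its full overlap ([tuple_bound]). Finally the
    hypotheses c < 3/(2r) and r >= 3 enter through the positive number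
    d0 = 1 - c (r + 1) / 2: for 3 <= a <= r they make n^a p^C(a,2) larger than
    n^2 p by a factor n^d0 ([clique_scale_gain]), so that an overlap in more
    than one edge gains a power of n per clique; for Q, when the overlaps at the
    two revelations are too small for this, the factors |B|/n of the block
    vertices that are new make up for it ([cost_quad]). With L large this gain
    exceeds any prescribed power of n. *)

(** * The modulus of complex numbers *)

Section ComplexModulus.
Variable R : realType.
Implicit Types x y z : Rcomplex R.

Definition cnorm z : R := `|z|.

Lemma cnorm_ge0 z : 0 <= cnorm z.
Proof. exact: normr_ge0. Qed.

Lemma cnormM x y : cnorm (x * y) = cnorm x * cnorm y.
Proof. exact: ComplexField.Normc.normcM. Qed.

Lemma cnorm1 : cnorm 1 = 1.
Proof. exact: ComplexField.Normc.normc1. Qed.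

Lemma cnormD x y : cnorm (x + y) <= cnorm x + cnorm y.
Proof. exact: ler_normD. Qed.

Lemma cnormZ (c : R) z : cnorm (c *: z) = `|c| * cnorm z.
Proof.
case: z => a b; rewrite /cnorm /Num.norm /=.
by rewrite !exprMn -mulrDr sqrtrM ?sqr_ge0 // sqrtr_sqr.
Qed.

Lemma cnorm_prod (I : finType) (P : pred I) (F : I -> Rcomplex R) :
  cnorm (\prod_(i | P i) F i) = \prod_(i | P i) cnorm (F i).
Proof. exact: (big_morph _ cnormM cnorm1). Qed.

Lemma cnorm_sum (I : finType) (P : pred I) (F : I -> Rcomplex R) :
  cnorm (\sum_(i | P i) F i) <= \sum_(i | P i) cnorm (F i).
Proof. exact: ler_norm_sum. Qed.

Lemma scalecMM (a b : R) x y : (a *: x) * (b *: y) = (a * b) *: (x * y).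
Proof. by rewrite -scalerAl mulrC -scalerAl scalerA [y * x]mulrC. Qed.

End ComplexModulus.

(** * Resampling a random subset on part of its ground set *)

Section ProductMeasure.
Variables (R : realType) (T : finType) (p : R).
Implicit Types (D G H S : {set T}).

Definition weight D G : R := \prod_(e in D) (if e \in G then p else 1 - p).

(** The elements of [D] are resampled, each kept with probability [p], while
    [G] is left as it is outside [D]. Taking [D] to be all edges gives the full
    expectation, a smaller [D] the conditional expectation given the outcome
    outside [D]; having one operation for both makes conditioning an identity
    between values of [condE]. *)
Definition condE (V : lmodType R) D (f : {set T} -> V) G : V :=
  \sum_(H in powerset D) weight D H *: f ((G :\: D) :|: H).

Definition free_of (U : Type) D (f : {set T} -> U) :=
  forall G G', G :\: D = G' :\: D -> f G = f G'.

Lemma sum_powerset_prod (A : comNzRingType) (a b : T -> A) D :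
  \sum_(H in powerset D) \prod_(e in D) (if e \in H then a e else b e)
  = \prod_(e in D) (a e + b e).
Proof.
rewrite (eq_bigr (fun e => if e \in D then a e + b e else 1 + 0)); last first.
  by move=> e ->.
rewrite (big_mkcond (fun e => e \in D)) /=.
rewrite (eq_bigr (fun e => (if e \in D then a e else 0) + (if e \in D then b e else 1))); last first.
  by move=> e _; case: (e \in D) => //; rewrite add0r.
rewrite bigA_distr.
rewrite [RHS](bigID (fun H : {set T} => H \in powerset D)) /= [X in _ = _ + X]big1 ?addr0; last first.
  move=> H; rewrite powersetE => /subsetPn[e eH eD].
  by rewrite (bigD1 e) //= eH (negbTE eD) mul0r.
apply: eq_big => // H.
rewrite powersetE => /subsetP HD.
rewrite big_mkcond /=; apply: eq_bigr => e _.
case: ifP => eD; case: ifP => eH //.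
by rewrite HD in eD.
Qed.

Lemma sum_weight D : \sum_(H in powerset D) weight D H = 1.
Proof.
rewrite sum_powerset_prod big1 // => e _; by rewrite addrC subrK.
Qed.

Lemma weight_split D1 D2 G1 G2 : [disjoint D1 & D2] -> G1 \subset D1 -> G2 \subset D2 ->
  weight (D1 :|: D2) (G1 :|: G2) = weight D1 G1 * weight D2 G2.
Proof.
move=> dis s1 s2; rewrite /weight (eq_bigl [predU D1 & D2]); last by move=> e; rewrite !inE.
rewrite bigU //=.
congr (_ * _); apply: eq_bigr => e eD; rewrite inE.
- case: (boolP (e \in G2)) => [/(subsetP s2) e2|_]; rewrite ?orbF //.
  by move: (disjointFr dis eD); rewrite e2.
- case: (boolP (e \in G1)) => [/(subsetP s1) e1|_] //.
  by move: (disjointFr dis e1); rewrite eD.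
Qed.

(** Fubini: a subset of a disjoint union is a pair of subsets, and the weights
    multiply. *)
Lemma condE_condE (V : lmodType R) D1 D2 (f : {set T} -> V) : [disjoint D1 & D2] ->
  condE (D1 :|: D2) f =1 condE D1 (condE D2 f).
Proof.
move=> dis G; rewrite /condE.
under [RHS]eq_bigr => G1 _ do rewrite scaler_sumr.
rewrite pair_big_dep /=.
rewrite (reindex_onto (fun u : {set T} * {set T} => u.1 :|: u.2)
   (fun H => (H :&: D1, H :&: D2))) /=; last first.
  move=> H; rewrite powersetE => HD; rewrite -setIUr; exact/setIidPl.
apply: eq_big => [[G1 G2]|[G1 G2]] /=; rewrite !powersetE.
  apply/andP/andP => [[/subsetP s /eqP[<- <-]]|[s1 s2]].
    by split; apply: subsetIr.
  split; first by apply: setUSS.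
  have i12 : G1 :&: D2 = set0.
    apply/eqP; rewrite setI_eq0; exact: (disjointWl s1).
  have i21 : G2 :&: D1 = set0.
    apply/eqP; rewrite setI_eq0 disjoint_sym; exact: (disjointWr s2).
  by rewrite !setIUl i12 i21 set0U setU0 (setIidPl s1) (setIidPl s2).
move=> /andP[_ /eqP[e1 e2]].
have s1 : G1 \subset D1 by rewrite -e1 subsetIr.
have s2 : G2 \subset D2 by rewrite -e2 subsetIr.
rewrite weight_split // scalerA; congr (_ *: f _).
apply/setP => x; rewrite !inE.
case: (boolP (x \in G1)) => [/(subsetP s1) x1|].
  by rewrite (disjointFr dis x1) /= !orbT.
by case: (x \in G2) => /=; rewrite ?orbT ?orbF //= negb_or andbA [_ && (x \notin D2)]andbC.
Qed.

Lemma condE_id (V : lmodType R) D (f : {set T} -> V) : free_of D f -> condE D f =1 f.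
Proof.
move=> ff G; rewrite /condE (eq_bigr (fun H => weight D H *: f G)).
  by rewrite -scaler_suml sum_weight scale1r.
move=> H; rewrite powersetE => HD; congr (_ *: _); apply: ff.
by rewrite setDUl setDDl setUid (eqP (_ : H :\: D == set0)) ?setU0 // setD_eq0.
Qed.

Lemma eq_condE (V : lmodType R) D (f g : {set T} -> V) : f =1 g -> condE D f =1 condE D g.
Proof. by move=> e G; apply: eq_bigr => H _; rewrite e. Qed.

Lemma condE_add (V : lmodType R) D (f g : {set T} -> V) G :
  condE D (fun H => f H + g H) G = condE D f G + condE D g G.
Proof. by rewrite /condE -big_split; apply: eq_bigr => H _; rewrite scalerDr. Qed.

Lemma condE_opp (V : lmodType R) D (f : {set T} -> V) G :
  condE D (fun H => - f H) G = - condE D f G.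
Proof. by rewrite /condE -sumrN; apply: eq_bigr => H _; rewrite scalerN. Qed.

Lemma condE_sub (V : lmodType R) D (f g : {set T} -> V) G :
  condE D (fun H => f H - g H) G = condE D f G - condE D g G.
Proof. by rewrite condE_add condE_opp. Qed.

Lemma condE_sum (V : lmodType R) D (I : finType) (P : pred I) (f : I -> {set T} -> V) G :
  condE D (fun H => \sum_(i | P i) f i H) G = \sum_(i | P i) condE D (f i) G.
Proof. by rewrite /condE exchange_big; apply: eq_bigr => H _; rewrite scaler_sumr. Qed.

Lemma condE_const (V : lmodType R) D (c : V) G : condE D (fun=> c) G = c.
Proof. exact: condE_id. Qed.

(** Taking out what is known; stated once for real and once for complex values
    because scalars act differently on the two. *)
Lemma condE_mulr D (f g : {set T} -> R) G : free_of D f ->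
  condE D (fun H => f H * g H : R^o) G = f G * condE D (g : _ -> R^o) G.
Proof.
move=> ff; rewrite /condE mulr_sumr; apply: eq_bigr => H; rewrite powersetE => HD.
rewrite /GRing.scale /= mulrCA; congr (_ * _ ); apply: ff.
by rewrite setDUl setDDl setUid (eqP (_ : H :\: D == set0)) ?setU0 // setD_eq0.
Qed.

Lemma condE_mulc D (f g : {set T} -> Rcomplex R) G : free_of D f ->
  condE D (fun H => f H * g H) G = f G * condE D g G.
Proof.
move=> ff; rewrite /condE mulr_sumr; apply: eq_bigr => H; rewrite powersetE => HD.
rewrite [in RHS]mulrC -scalerAl mulrC; congr (_ *: (_ * _)); apply: ff.
by rewrite setDUl setDDl setUid (eqP (_ : H :\: D == set0)) ?setU0 // setD_eq0.
Qed.

Lemma condE_scale D (f : {set T} -> Rcomplex R) (c : R) G :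
  condE D (fun H => c *: f H) G = c *: condE D f G.
Proof. by rewrite /condE scaler_sumr; apply: eq_bigr => H _; rewrite !scalerA mulrC. Qed.

(** Independence: the mean of a product of functions of single elements is the
    product of their means. *)
Lemma condE_prodr D (g : T -> bool -> R) G :
  condE D (fun H => \prod_(e in D) g e (e \in H) : R^o) G =
  \prod_(e in D) (p * g e true + (1 - p) * g e false).
Proof.
rewrite -sum_powerset_prod; apply: eq_bigr => H; rewrite powersetE => HD.
rewrite /weight /GRing.scale /= -big_split; apply: eq_bigr => e eD /=.
by rewrite !inE eD /=; case: ifP.
Qed.

Lemma scaler_prod_c (D : {set T}) (a : T -> R) (b : T -> Rcomplex R) :
  (\prod_(e in D) a e) *: (\prod_(e in D) b e) = \prod_(e in D) (a e *: b e).
Proof.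
elim/big_rec3: _ => [|e x y z _ <-]; first by rewrite scale1r.
by rewrite scalecMM.
Qed.

Lemma condE_prodc D (g : T -> bool -> Rcomplex R) G :
  condE D (fun H => \prod_(e in D) g e (e \in H)) G =
  \prod_(e in D) (p *: g e true + (1 - p) *: g e false).
Proof.
rewrite -sum_powerset_prod; apply: eq_bigr => H; rewrite powersetE => HD.
rewrite /weight scaler_prod_c; apply: eq_bigr => e eD /=.
by rewrite !inE eD /=; case: ifP.
Qed.

Hypothesis p01 : 0 <= p <= 1.

Lemma weight_ge0 D G : 0 <= weight D G.
Proof.
case/andP: p01 => p0 p1.
by apply: prodr_ge0 => e _; case: ifP => _ //; rewrite subr_ge0.
Qed.

Lemma le_condE D (f g : {set T} -> R) G : (forall H, f H <= g H) ->
  condE D (f : _ -> R^o) G <= condE D (g : _ -> R^o) G.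
Proof. by move=> fg; apply: ler_sum => H _; rewrite /GRing.scale /= ler_wpM2l ?weight_ge0. Qed.

Lemma condE_ge0 D (f : {set T} -> R) G : (forall H, 0 <= f H) ->
  0 <= condE D (f : _ -> R^o) G.
Proof. by move=> f0; apply: sumr_ge0 => H _; rewrite /GRing.scale /= mulr_ge0 ?weight_ge0. Qed.

Lemma cnorm_condE D (f : {set T} -> Rcomplex R) G :
  cnorm (condE D f G) <= condE D (fun H => cnorm (f H) : R^o) G.
Proof.
apply: le_trans (cnorm_sum _ _) _; apply: ler_sum => H _.
by rewrite cnormZ ger0_norm ?weight_ge0.
Qed.

Lemma norm_condE D (f : {set T} -> R) G :
  `|condE D (f : _ -> R^o) G| <= condE D (fun H => `|f H| : R^o) G.
Proof.
apply: le_trans (ler_norm_sum _ _ _) _; apply: ler_sum => H _.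
by rewrite /GRing.scale /= normrM ger0_norm ?weight_ge0.
Qed.

End ProductMeasure.

(** * Edges inside a vertex set *)

Section Edges.
Variable V : finType.
Implicit Types A B S : {set V}.

Definition edges A : {set {set V}} := [set e : {set V} | (#|e| == 2%N) && (e \subset A)].

Lemma card_edges A : #|edges A| = 'C(#|A|, 2).
Proof. by rewrite -cards_draws; apply: eq_card => e; rewrite !inE andbC. Qed.

Lemma edgesI A B : edges A :&: edges B = edges (A :&: B).
Proof. by apply/setP => e; rewrite !inE subsetI; case: (#|e| == 2). Qed.

Lemma edgesS A B : A \subset B -> edges A \subset edges B.
Proof.
by move=> s; apply/subsetP => e; rewrite !inE => /andP[-> /subset_trans]; apply.
Qed.

Lemma card_new_edges A S : #|edges A :\: edges S| = ('C(#|A|, 2) - 'C(#|A :&: S|, 2))%N.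
Proof. by rewrite cardsD edgesI !card_edges. Qed.

End Edges.

(** * Weighted counting of tuples of cliques *)

Section Cover.
Variables (R : realType) (V : finType) (p : R) (w : V -> R) (R0 : {set V}).
Hypothesis p01 : 0 <= p <= 1.
Hypothesis w_gt0 : forall v, 0 < w v.
Implicit Types A S : {set V}.

(** What a clique [A] contributes when the vertices of [S] are already known:
    with [w v] the inverse of the number of choices for [v], the number of ways
    to choose the new vertices times the probability of the new edges. *)
Definition cost A S : R :=
  (\prod_(v in A :\: S) (w v)^-1) * p ^+ ('C(#|A|, 2) - 'C(#|A :&: S|, 2)).

Lemma cost_ge0 A S : 0 <= cost A S.
Proof.
case/andP: p01 => p0 _; rewrite mulr_ge0 ?exprn_ge0 //.
by apply: prodr_ge0 => v _; rewrite invr_ge0 ltW.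
Qed.

(** Revealing the sets in the order of their indices, each new vertex and each
    new edge of the union is counted when it first appears. Edges of [edges A]
    between known vertices may be new as well, hence an inequality. *)
Lemma cost_chain (F : nat -> {set V}) L :
  (\prod_(v in (\bigcup_(i < L) F i) :\: R0) (w v)^-1)
    * p ^+ #|(\bigcup_(i < L) edges (F i)) :\: edges R0|
  <= \prod_(i < L) cost (F i) (R0 :|: \bigcup_(j < i) F j).
Proof.
case/andP: p01 => p0 p1.
elim: L => [|L IH]; first by rewrite !big_ord0 !set0D big_set0 cards0 mulr1.
rewrite big_ord_recr /= [X in X :\: edges R0]big_ord_recr /= [leRHS]big_ord_recr /=.
set c := \bigcup_(i < L) F i in IH *.
set ec := \bigcup_(i < L) edges (F i) in IH *.
set A := F L.
apply: le_trans (ler_wpM2r (cost_ge0 _ _) IH).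
have -> : (c :|: A) :\: R0 = (c :\: R0) :|: (A :\: (R0 :|: c)).
  apply/setP => v; rewrite !inE; case: (v \in R0) => //=.
  by case: (v \in c).
rewrite (eq_bigl [predU (c :\: R0) & (A :\: (R0 :|: c))]); last first.
  by move=> v; rewrite !inE.
rewrite bigU /=; last first.
  rewrite -setI_eq0; apply/eqP/setP => v; rewrite !inE.
  by case: (v \in R0); case: (v \in c); rewrite //= ?andbF.
rewrite /cost [in leRHS]mulrACA -exprD ler_wpM2l //.
  by rewrite mulr_ge0 // prodr_ge0 // => v _; rewrite invr_ge0 ltW.
apply: ler_wiXn2l => //.
rewrite -card_new_edges -cardsUI.
have sub : ec \subset edges c.
  by apply/bigcupsP => i _; apply/edgesS/bigcup_sup.
rewrite [X in (_ + X)%N](_ : _ = 0%N) ?addn0.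
  apply/subset_leq_card/subsetP => e; rewrite !(in_setU, in_setD).
  case/orP => [/andP[-> ->] //|]; move=> /andP[n ->]; rewrite orbT andbT.
  by apply: contra n => /(subsetP (edgesS (subsetUl _ _))).
apply/eqP; rewrite cards_eq0; apply/eqP/setP => e; rewrite in_set0.
apply/negbTE/negP; rewrite in_setI !in_setD => /andP[/andP[_ h1] /andP[h2 _]].
by move: h2; rewrite (subsetP (edgesS (subsetUr R0 c)) _ (subsetP sub _ h1)).
Qed.

Definition others L (f : {ffun 'I_L -> {set V}}) i :=
  R0 :|: \bigcup_(j | j != i) f j.

(** A single order of revelation would not do: the first set sees none of the
    others. In the reverse order, the set with index [i] sees exactly those it
    missed before. Multiplying the two bounds gives one pair of costs per set,
    whose known parts [S1] and [S2] together cover all the others. *)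
Lemma tuple_bound L (f : {ffun 'I_L -> {set V}}) (kap : R) : 0 <= kap ->
  (forall i S1 S2, R0 \subset S1 -> R0 \subset S2 -> S1 :|: S2 = others f i ->
     cost (f i) S1 * cost (f i) S2 <= kap ^+ 2) ->
  p ^+ #|(\bigcup_i edges (f i)) :\: edges R0| <=
  kap ^+ L * \prod_(v in (\bigcup_i f i) :\: R0) w v.
Proof.
case/andP: p01 => p0 p1 k0 H.
(* [cost_chain] is about sequences indexed by nat, hence the junk value. *)
pose F k := if insub k is Some i then f i else set0.
have FE (i : 'I_L) : F i = f i by rewrite /F valK.
have c1 := cost_chain F L.
have c2 := cost_chain (fun k => F (L - k.+1)%N) L.
have e1 : \bigcup_(i < L) F (L - i.+1)%N = \bigcup_(i < L) F i.
  by rewrite [RHS](reindex_inj rev_ord_inj).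
have e2 : \bigcup_(i < L) edges (F (L - i.+1)%N) = \bigcup_(i < L) edges (F i).
  by rewrite [RHS](reindex_inj rev_ord_inj).
rewrite e1 e2 in c2.
have e3 : \bigcup_(i < L) F i = \bigcup_i f i by apply: eq_bigr.
have e4 : \bigcup_(i < L) edges (F i) = \bigcup_i edges (f i).
  by apply: eq_bigr => i _; rewrite FE.
rewrite e3 e4 in c1 c2.
rewrite [leRHS](reindex_inj rev_ord_inj) /= in c2.
set P := \prod_(v in _) (w v)^-1 in c1 c2.
have P0 : 0 < P by apply: prodr_gt0 => v _; rewrite invr_gt0.
set X := p ^+ _ in c1 c2 *.
have X0 : 0 <= X by rewrite exprn_ge0.
(* Position [i] of the reversed chain is index [L - i.+1] of the original one;
   [c2] has been reindexed so that both products run over the same [i]. *)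
have key : (P * X) ^+ 2 <= (kap ^+ L) ^+ 2.
  rewrite -exprM mulnC exprM expr2.
  apply: le_trans (ler_pM _ _ c1 c2) _; rewrite ?mulr_ge0 ?(ltW P0) //.
  rewrite -big_split /= -[X in _ ^+ X]card_ord -prodr_const.
  apply: ler_prod => i _; rewrite mulr_ge0 ?cost_ge0 //=.
  have iE : (L - (L - i.+1).+1)%N = i by have := ltn_ord i; lia.
  rewrite iE FE; apply: H; rewrite ?subsetUl //.
  rewrite /others -setUUr; congr (_ :|: _).
  apply/setP => v; rewrite in_setU; apply/orP/bigcupP.
    case=> /bigcupP[j _ vj].
      have jL : (j < L)%N by apply: ltn_trans (ltn_ord j) (ltn_ord i).
      exists (Ordinal jL); last by rewrite -FE.
      by rewrite -val_eqE /= ltn_eqF.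
    have jL : (L - j.+1 < L)%N by have := ltn_ord i; lia.
    exists (Ordinal jL); last by rewrite -FE.
    by rewrite -val_eqE /=; have := ltn_ord j; have := ltn_ord i; lia.
  case=> j; rewrite -val_eqE /= neq_ltn => /orP[ji|ij] vj; [left|right].
    by apply/bigcupP; exists (Ordinal ji) => //=; rewrite FE.
  have ij' : (L - j.+1 < L - i.+1)%N by have := ltn_ord j; lia.
  apply/bigcupP; exists (Ordinal ij') => //=.
  by rewrite (_ : (L - (L - j.+1).+1)%N = j) ?FE //; have := ltn_ord j; lia.
have {key} : P * X <= kap ^+ L.
  by move: key; rewrite ler_pXn2r // nnegrE ?exprn_ge0 // mulr_ge0 // ltW.
rewrite mulrC -ler_pdivlMr // /P prodfV invrK; exact.
Qed.

(** A tuple of sets is the same thing as a map sending each vertex [v] to the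
    set of indices [i] with [v] in [f i]. Read this way the sum factorizes over
    the vertices, and [v] contributes at most [1 + 2 ^ L * w v]. The total is
    bounded because [w] has bounded sum. *)
Lemma sum_covers L :
  \sum_(f : {ffun 'I_L -> {set V}}) \prod_(v in (\bigcup_i f i) :\: R0) w v
  <= expR (2 ^+ L * (\sum_v w v + #|R0|%:R)).
Proof.
pose w' v := if v \in R0 then 1 else w v.
have w'0 v : 0 <= w' v by rewrite /w'; case: ifP => // _; exact: ltW.
have -> : \sum_(f : {ffun 'I_L -> {set V}}) \prod_(v in (\bigcup_i f i) :\: R0) w v
  = \sum_(g : {ffun V -> {set 'I_L}}) \prod_v (if g v == set0 then 1 else w' v).
  rewrite (reindex (fun g : {ffun V -> {set 'I_L}} => [ffun i => [set v | i \in g v]])) /=.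
    apply: eq_bigr => g _; rewrite big_mkcond; apply: eq_bigr => v _.
    rewrite in_setD; have -> : (v \in \bigcup_i [ffun i => [set v | i \in g v]] i) = (g v != set0).
      apply/bigcupP/set0Pn => [[i _]|[i iv]]; last by exists i; rewrite // ffunE inE.
      by rewrite ffunE inE => iv; exists i.
    by rewrite /w'; case: (v \in R0); case: (g v == set0).
  exists (fun f : {ffun 'I_L -> {set V}} => [ffun v => [set i | v \in f i]]) => f _ /=.
    by apply/ffunP => v; apply/setP => i; rewrite !ffunE !inE ffunE inE.
  by apply/ffunP => v; apply/setP => i; rewrite !ffunE !inE ffunE inE.
rewrite -(bigA_distr_bigA (fun v (J : {set 'I_L}) => if J == set0 then 1 else w' v)) /=.
have sw' : \sum_v w' v <= \sum_v w v + #|R0|%:R.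
  rewrite -sum1_card natr_sum [X in _ <= _ + X]big_mkcond -big_split /=.
  by apply: ler_sum => v _; rewrite /w'; case: (v \in R0); rewrite ?addr0 // lerDr ltW.
apply: le_trans (_ : expR (2 ^+ L * \sum_v w' v) <= _); last first.
  by rewrite ler_expR ler_wpM2l // exprn_ge0.
rewrite mulr_sumr expR_sum; apply: ler_prod => v _; apply/andP; split.
  by apply: sumr_ge0 => J _; case: ifP.
rewrite (bigD1 set0) //= eqxx.
apply: le_trans (expR_ge1Dx _); rewrite lerD2l.
apply: le_trans (_ : \sum_(J : {set 'I_L}) w' v <= _).
  rewrite [leRHS](bigD1 set0) //= ler_wpDl //.
  by apply: ler_sum => J /negbTE ->.
by rewrite sumr_const -cardsT -powersetT card_powerset cardsT card_ord -[in leRHS]natrX mulr_natl.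
Qed.

End Cover.

(** * A bound for high moments of sums over cliques *)

Section Moment.
Variables (R : realType) (V : finType) (p : R).
Hypothesis p01 : 0 <= p <= 1.
Implicit Types (A S : {set V}) (G : {set {set V}}).

Definition E (f : {set {set V}} -> R) : R := condE p (edges [set: V]) (f : _ -> R^o) set0.

(** An edge covered by some [O i] contributes a product of at most [L] factors
    [1 + p] when it is present, which happens with probability [p], and at
    least one factor [p] when it is absent. *)
Lemma E_prod_bound L (O : 'I_L -> {set {set V}}) :
  (forall i, O i \subset edges [set: V]) ->
  E (fun G => \prod_i \prod_(e in O i) ((e \in G)%:R + p)) <=
  (2 ^+ L.+1 * p) ^+ #|\bigcup_i O i|.
Proof.
move=> OD; case/andP: (p01) => p0 p1.
pose g (e : {set V}) (b : bool) : R := \prod_(i | e \in O i) (b%:R + p).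
rewrite /E (eq_condE _ _ (g := fun G => \prod_(e in edges [set: V]) g e (e \in G) : R^o)); last first.
  move=> G; rewrite (exchange_big_dep (fun e => e \in edges [set: V])) //=.
  by move=> i e _; apply/subsetP.
rewrite (condE_prodr p _ g) /g -prodr_const (eq_bigl (fun e => (e \in edges [set: V]) && (e \in \bigcup_i O i))); last first.
  move=> e /=; case: (boolP (e \in \bigcup_i O i)); rewrite ?andbF // andbT.
  by move=> eO; apply/esym/(subsetP _ _ eO)/bigcupsP.
rewrite big_mkcondr; apply: ler_prod => e eD.
have ge0 b : 0 <= \prod_(i | e \in O i) ((b : bool)%:R + p).
  by apply: prodr_ge0 => i _; rewrite addr_ge0.
have q0 : 0 <= 1 - p by rewrite subr_ge0.
rewrite (addr_ge0 (mulr_ge0 p0 (ge0 true)) (mulr_ge0 q0 (ge0 false))) /=.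
case: ifPn => [/bigcupP[i0 _ ei0]|eO]; last first.
  have em i : e \in O i = false.
    by apply/negbTE; apply: contra eO => eOi; apply/bigcupP; exists i.
  by rewrite !(eq_bigl _ _ em) !big_pred0_eq !mulr1 addrC subrK.
have -> : 2 ^+ L.+1 * p = p * 2 ^+ L + p * 2 ^+ L by rewrite exprS; ring.
have p2 : \prod_(i < L | e \in O i) (1 + p) <= 2 ^+ L.
  apply: le_trans (_ : \prod_(i < L) 2 <= _); last by rewrite prodr_const card_ord.
  rewrite big_mkcond; apply: ler_prod => i _; case: ifP => _; lra.
apply: lerD; first by rewrite ler_wpM2l.
rewrite (bigD1 i0) //= mulr0n add0r.
rewrite mulrCA ler_wpM2l //.
apply: le_trans (_ : 1 * 1 <= _); last by rewrite mulr1 exprn_ege1 // ler1n.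
apply: ler_pM; [lra| |lra|].
- by apply: prodr_ge0.
- by apply: prodr_ile1 => i _; rewrite p0 p1.
Qed.

Variables (w : V -> R) (R0 : {set V}).
Hypothesis w_gt0 : forall v, 0 < w v.

(** The common source of all moment estimates. [R0] is a set of vertices known
    from the start (the end points of an edge when its coefficient is studied)
    and [P A N] is the lower bound on the overlap [N] of [A] with the rest of
    the tuple that is forced when the tuple contributes. It suffices to
    bound the product of the two costs of a clique under this condition. *)
Lemma moment_bound (r L : nat) (calA : pred {set V}) (h : {set V} -> {set {set V}} -> R)
   (P : {set V} -> {set V} -> bool) (C kap : R) :
  (forall A, calA A -> #|A| = r) -> 1 <= C -> 0 <= kap ->
  (forall A G, calA A -> `|h A G| <= C * \prod_(e in edges A :\: edges R0) ((e \in G)%:R + p)) ->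
  (forall f : {ffun 'I_L -> {set V}}, (forall i, calA (f i)) ->
     E (fun G => \prod_i h (f i) G) != 0 ->
     forall i, P (f i) (f i :&: others R0 f i)) ->
  (forall A S1 S2, calA A -> R0 \subset S1 -> R0 \subset S2 -> P A (A :&: (S1 :|: S2)) ->
     cost p w A S1 * cost p w A S2 <= kap ^+ 2) ->
  E (fun G => (\sum_(A | calA A) h A G) ^+ L) <=
  (C * (2 ^+ L.+1) ^+ 'C(r, 2) * kap) ^+ L * expR (2 ^+ L * (\sum_v w v + #|R0|%:R)).
Proof.
move=> cardA C_ge1 k0 hb van kapP; case/andP: (p01) => p0 p1.
have C_ge0 : 0 <= C by apply: le_trans C_ge1.
rewrite /E (eq_condE _ _ (g := fun G => \sum_(f : {ffun 'I_L -> {set V}})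
    \prod_i (if calA (f i) then h (f i) G else 0) : R^o)); last first.
  move=> G; rewrite big_mkcond -[in X in _ ^+ X](card_ord L) -prodr_const /=.
  by rewrite bigA_distr_bigA.
rewrite condE_sum.
apply: le_trans (ler_wpM2l _ (sum_covers R0 w_gt0 L)); last first.
  by rewrite exprn_ge0 // !mulr_ge0 // !exprn_ge0.
rewrite mulr_sumr; apply: ler_sum => f _.
set rhs := (X in _ <= X).
have rhs0 : 0 <= rhs.
  by rewrite mulr_ge0 ?exprn_ge0 ?mulr_ge0 ?exprn_ge0 // prodr_ge0 // => v _; exact: ltW.
case: (boolP [forall i, calA (f i)]) => [/forallP fA|]; last first.
  case/forallPn => i /negbTE fi.
  rewrite (eq_condE _ _ (g := fun=> 0 : R^o)) ?condE_const // => G.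
  by rewrite (bigD1 i) //= fi mul0r.
rewrite (eq_condE _ _ (g := fun G => \prod_i h (f i) G : R^o)); last first.
  by move=> G; apply: eq_bigr => i _; rewrite fA.
case: (eqVneq (E (fun G => \prod_i h (f i) G)) 0) => [|ne0].
  by rewrite /E => ->.
have fP := van f fA ne0.
apply: le_trans (ler_norm _) _.
apply: le_trans (norm_condE p01 _ _ _) _.
pose O i := edges (f i) :\: edges R0.
apply: le_trans (_ : E (fun G => C ^+ L * \prod_i \prod_(e in O i) ((e \in G)%:R + p)) <= _).
  apply: le_condE => // G; rewrite normr_prod.
  rewrite -[in X in C ^+ X](card_ord L) -prodr_const -big_split /=.
  by apply: ler_prod => i _; rewrite normr_ge0 hb.
rewrite /E condE_mulr //.
have OD i : O i \subset edges [set: V].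
  by apply: subset_trans (subsetDl _ _) (edgesS (subsetT _)).
apply: le_trans (ler_wpM2l _ (E_prod_bound OD)) _; first by rewrite exprn_ge0.
have OU : \bigcup_i O i = (\bigcup_i edges (f i)) :\: edges R0.
  apply/setP => e; rewrite inE; apply/bigcupP/andP.
    by case=> i _; rewrite inE => /andP[-> ei]; split=> //; apply/bigcupP; exists i.
  by case=> e0 /bigcupP[i _ ei]; exists i; rewrite // inE e0.
have tb : p ^+ #|(\bigcup_i edges (f i)) :\: edges R0| <=
  kap ^+ L * \prod_(v in (\bigcup_i f i) :\: R0) w v.
  apply: tuple_bound => // i S1 S2 s1 s2 e; apply: kapP => //.
  by rewrite e.
have cU : (#|\bigcup_i O i| <= 'C(r, 2) * L)%N.
  rewrite mulnC -[X in (_ <= X * _)%N](card_ord L) -sum_nat_const.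
  elim/big_rec2: _ => [|i y s _ IH]; first by rewrite cards0.
  apply: leq_trans (leq_card_setU _ _) _; apply: leq_add IH.
  by apply: leq_trans (subset_leq_card (subsetDl _ _)) _; rewrite card_edges cardA.
have t1 : 1 <= 2 ^+ L.+1 :> R by rewrite exprn_ege1 // ler1n.
apply: le_trans (_ : C ^+ L * ((2 ^+ L.+1) ^+ ('C(r, 2) * L) * (kap ^+ L * \prod_(v in (\bigcup_i f i) :\: R0) w v)) <= _).
  rewrite ler_wpM2l ?exprn_ge0 // exprMn; apply: ler_pM; rewrite ?exprn_ge0 //.
    exact: ler_weXn2l.
  by rewrite OU.
by rewrite /rhs exprM !exprMn !mulrA lexx.
Qed.

End Moment.

(** * Taylor expansion of exp(i x), and the decay from one edge *)

Section Taylor.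
Import topology normedtype derive numFieldNormedType.Exports.
Variable R : realType.

Lemma derive_growth (f df : R -> R) k :
  (forall x, is_derive x (1 : R) f (df x)) -> f 0 = 0 ->
  (forall x, `|df x| <= `|x| ^+ k) -> forall x, `|f x| <= `|x| ^+ k.+1.
Proof.
move=> fd f0 dfk x.
have cf : continuous f.
  move=> y; apply/differentiable_continuous/derivable1_diffP.
  by have ? := fd y; exact: ex_derive.
have [x0|x0] := leP 0 x.
  have [c] := MVT_segment x0 (fun y _ => fd y) (continuous_subspaceT cf).
  rewrite f0 !subr0 in_itv /= => /andP[c0 cx] ->.
  rewrite normrM exprSr ler_wpM2r //; apply: le_trans (dfk c) _.
  by rewrite lerXn2r ?nnegrE // !ger0_norm // (le_trans c0).
have [c] := MVT_segment (ltW x0) (fun y _ => fd y) (continuous_subspaceT cf).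
rewrite f0 !sub0r in_itv /= => /andP[xc c0] /(congr1 (fun z => - z)).
rewrite opprK mulrN opprK => ->.
rewrite normrM exprSr ler_wpM2r //; apply: le_trans (dfk c) _.
by rewrite lerXn2r ?nnegrE // !ler0_norm ?lerN2 // ltW.
Qed.

(** Integrating the Taylor polynomial of one function gives that of the other,
    so cos and sin are treated in one induction. The bounds on the
    coefficients become the constants in the expansion of exp(i s Q). *)
Lemma taylor_trig k : exists P Q : {poly R},
  [/\ (size P <= k)%N, (size Q <= k)%N, forall j, `|P`_j| <= 1 & forall j, `|Q`_j| <= 1]
  /\ forall x, `|cos x - P.[x]| <= `|x| ^+ k /\ `|sin x - Q.[x]| <= `|x| ^+ k.
Proof.
elim: k => [|k [P [Q [[sP sQ bP bQ] H]]]].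
  exists 0, 0; split; first by rewrite size_poly0; split => // j; rewrite coef0 normr0.
  move=> x; rewrite !horner0 !subr0 expr0 !ler_norml cos_le1 cos_geN1 sin_le1 sin_geN1.
  by [].
pose Q' := \poly_(j < k.+1) (if j is i.+1 then P`_i / i.+1%:R else 0).
pose P' := \poly_(j < k.+1) (if j is i.+1 then - (Q`_i / i.+1%:R) else 1).
have dQ : Q'^`() = P.
  apply/polyP => j; rewrite coef_deriv coef_poly ltnS.
  case: ltnP => jk; last by rewrite mul0rn nth_default // (leq_trans sP).
  by rewrite -[LHS]mulr_natr mulfVK // pnatr_eq0.
have dP : P'^`() = - Q.
  apply/polyP => j; rewrite coef_deriv coef_poly ltnS coefN.
  case: ltnP => jk; last by rewrite mul0rn nth_default ?oppr0 // (leq_trans sQ).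
  by rewrite -[LHS]mulr_natr mulNr mulfVK // pnatr_eq0.
have small (a : R) i : `|a| <= 1 -> `|a / i.+1%:R| <= 1.
  move=> a1; rewrite normrM normfV ler_pdivrMr ?normr_gt0 ?pnatr_eq0 // mul1r.
  by apply: le_trans a1 _; rewrite ger0_norm // ler1n.
exists P', Q'; split.
  split; [exact: size_poly|exact: size_poly| |] => -[|j]; rewrite coef_poly.
  - by rewrite /= normr1.
  - by case: ifP; rewrite ?normr0 // normrN small.
  - by rewrite /= normr0.
  - by case: ifP; rewrite ?normr0 // small.
move=> x; split.
  apply: (@derive_growth (fun y => cos y - P'.[y]) (fun y => - (sin y - Q.[y]))) => [y||y].
  - have := is_deriveB (is_derive_cos y) (is_derive_poly P' y).
    by rewrite dP hornerN opprB opprK addrC.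
  - rewrite cos0 horner_coef0 coef_poly /= subrr; by [].
  - rewrite normrN; exact: (H y).2.
apply: (@derive_growth (fun y => sin y - Q'.[y]) (fun y => cos y - P.[y])) => [y||y].
- have := is_deriveB (is_derive_sin y) (is_derive_poly Q' y).
  by rewrite dQ.
- by rewrite sin0 horner_coef0 coef_poly /= subrr.
- exact: (H y).1.
Qed.

Lemma cnormE (a b : R) : cnorm (Complex a b) = Num.sqrt (a ^+ 2 + b ^+ 2).
Proof. by []. Qed.

Lemma cnorm_le (a b : R) : cnorm (Complex a b) <= `|a| + `|b|.
Proof.
rewrite cnormE -(@ler_pXn2r _ 2) ?nnegrE ?sqrtr_ge0 ?addr_ge0 //.
rewrite sqr_sqrtr ?addr_ge0 ?sqr_ge0 // sqrrD !real_normK ?num_real //.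
by have := mulr_ge0 (normr_ge0 a) (normr_ge0 b); rewrite mulr2n; lra.
Qed.

Lemma taylor_expi k : exists c : nat -> Rcomplex R,
  (forall j, cnorm (c j) <= 2) /\
  forall x, cnorm (expi x - \sum_(j < k) (x ^+ j) *: c j) <= 2 * `|x| ^+ k.
Proof.
have [P [Q [[sP sQ bP bQ] H]]] := taylor_trig k.
exists (fun j => Complex P`_j Q`_j : Rcomplex R); split=> [j|x].
  by apply: le_trans (cnorm_le _ _) _; rewrite (_ : 2 = 1 + 1) // lerD.
have -> : \sum_(j < k) (x ^+ j) *: (Complex P`_j Q`_j : Rcomplex R) =
   Complex P.[x] Q.[x].
  rewrite (horner_coef_wide _ sP) (horner_coef_wide _ sQ).
  elim/big_rec3: _ => //= j a b c _ ->.
  by congr Complex; rewrite mulrC.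
apply: (le_trans (cnorm_le (cos x - P.[x]) (sin x - Q.[x]))); have [h1 h2] := H x; lra.
Qed.

Lemma expiD (x y : R) : expi (x + y) = expi x * expi y.
Proof.
rewrite /expi cosD sinD; apply/eqP; rewrite eq_complex /=.
by apply/andP; split; apply/eqP; ring.
Qed.

Lemma expi0 : expi (0 : R) = 1.
Proof. by rewrite /expi cos0 sin0. Qed.

Lemma expi_sum (I : finType) (P : pred I) (F : I -> R) :
  expi (\sum_(i | P i) F i) = \prod_(i | P i) expi (F i).
Proof. exact: (big_morph _ expiD expi0). Qed.

Lemma cnorm_expi (x : R) : cnorm (expi x) = 1.
Proof. by rewrite cnormE cos2Dsin2 sqrtr1. Qed.

(** Halving the angle turns the claim into a lower bound for the absolute value
    of the sine, which needs Taylor only to third order. *)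
Lemma cos_le_quad (x : R) : `|x| <= 1 -> cos x <= 1 - x ^+ 2 / 4.
Proof.
move=> x1.
have s1 : forall y : R, `|sin y| <= `|y| ^+ 1.
  apply: (@derive_growth sin cos 0) => [|y]; first exact: sin0.
  by rewrite expr0 ler_norml cos_le1 cos_geN1.
have s2 : forall y : R, `|cos y - 1| <= `|y| ^+ 2.
  apply: (@derive_growth (fun y => cos y - 1) (fun y => - sin y)) => [y||y].
  - by have := is_deriveB (is_derive_cos y) (is_derive_cst (1 : R) y 1); rewrite subr0.
  - by rewrite cos0 subrr.
  - by rewrite normrN s1.
have s3 : forall y : R, `|sin y - y| <= `|y| ^+ 3.
  apply: (@derive_growth (fun y => sin y - y) (fun y => cos y - 1)) => [|y].
  - by rewrite sin0 subrr.
  - exact: s2.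
pose y := x / 2.
have -> : x = y *+ 2 by rewrite /y mulr2n; lra.
have y2 : `|y| <= 1 / 2 by rewrite /y normrM (@ger0_norm _ 2^-1) ?invr_ge0 ?ler0n //; lra.
rewrite cos_mulr2n.
have hs : 3 / 4 * `|y| <= `|sin y|.
  have h3 := s3 y.
  have : `|y| <= `|sin y - y| + `|sin y|.
    by have := ler_normB (sin y) (sin y - y); rewrite subKr addrC.
  have : `|y| ^+ 3 <= 1 / 4 * `|y|.
    rewrite exprSr ler_wpM2r // expr2; have := normr_ge0 y; nra.
  lra.
have q0 : 0 <= 3 / 4 * `|y| by have := normr_ge0 y; lra.
have : (3 / 4 * `|y|) ^+ 2 <= `|sin y| ^+ 2 by rewrite lerXn2r ?nnegrE.
rewrite exprMn !real_normK ?num_real // => h.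
have := cos2Dsin2 y; rewrite -mulr_natr.
have := sqr_ge0 y; nra.
Qed.

(** The squared modulus is [1 - 2 p (1 - p) (1 - cos x)]; both [p <= 1/2] and
    [cos_le_quad] lose a constant factor only. *)
Lemma cnorm_bernoulli (p x : R) : 0 <= p -> p <= 1 / 2 -> `|x| <= 1 ->
  cnorm (p *: expi x + (1 - p) *: (expi 0 : Rcomplex R)) <= expR (- (p * x ^+ 2 / 8)).
Proof.
move=> p0 p1 x1.
rewrite expi0.
have c1 := cos_le_quad x1.
apply: le_trans (_ : Num.sqrt (1 - p * x ^+ 2 / 4) <= _).
  have -> : p *: expi x + (1 - p) *: (1 : Rcomplex R) =
     Complex (p * cos x + (1 - p) * 1) (p * sin x + (1 - p) * 0) by [].
  rewrite cnormE ler_wsqrtr // mulr0 mulr1 addr0.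
  have -> : (p * cos x + (1 - p)) ^+ 2 + (p * sin x) ^+ 2 =
     p ^+ 2 * (cos x ^+ 2 + sin x ^+ 2) + (1 - p) ^+ 2 + 2 * p * (1 - p) * cos x by ring.
  rewrite cos2Dsin2.
  have q0 : 0 <= p * (1 - p) by apply: mulr_ge0 => //; lra.
  have h1 : 0 <= p * (1 - p) * (1 - x ^+ 2 / 4 - cos x) by apply: mulr_ge0 => //; lra.
  have h2 : 0 <= p * (1 / 2 - p) * x ^+ 2.
    by rewrite mulr_ge0 ?sqr_ge0 // mulr_ge0 //; lra.
  lra.
have hx : 0 <= 1 - p * x ^+ 2 / 4.
  have : x ^+ 2 <= 1 by rewrite -real_normK ?num_real // exprn_ile1.
  have := sqr_ge0 x; nra.
rewrite -(@ler_pXn2r _ 2) ?nnegrE ?sqrtr_ge0 ?expR_ge0 // sqr_sqrtr //.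
rewrite -expRM_natl; apply: le_trans (expR_ge1Dx _) ; lra.
Qed.

End Taylor.

(** * Monomials in the edge indicators *)

Section Monomials.
Variables (R : realType) (T : finType) (p : R).
Implicit Types (S D G : {set T}).

Definition mono S G : R := \prod_(e in S) (e \in G)%:R.

Lemma mono_ge0 S G : 0 <= mono S G.
Proof. by apply: prodr_ge0. Qed.

Lemma monoE S G : mono S G = (S \subset G)%:R.
Proof.
case: (boolP (S \subset G)) => [/subsetP s|/subsetPn[e eS eG]].
  by rewrite /mono big1 // => e /s ->.
by rewrite /mono (bigD1 e) //= (negbTE eG) mul0r.
Qed.

Lemma monoU S S' G : mono (S :|: S') G = mono S G * mono S' G.
Proof. by rewrite !monoE subUset -natrM mulnb. Qed.

Lemma prod_free_of (V : comNzRingType) (I : finType) (P : pred I) (h : I -> {set T} -> V) D :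
  (forall i, P i -> free_of D (h i)) -> free_of D (fun G => \prod_(i | P i) h i G).
Proof. by move=> H G G' e; apply: eq_bigr => i Pi; apply: (H i Pi). Qed.

Lemma ind_free_of (e : T) D : e \notin D -> free_of D (fun G => (e \in G)%:R : R).
Proof. by move=> eD G G' /setP/(_ e); rewrite !inE eD /= => ->. Qed.

Lemma mono_free_of S D : [disjoint S & D] -> free_of D (mono S).
Proof.
move=> d; apply: prod_free_of => e eS; apply: ind_free_of.
by rewrite (disjointFr d eS).
Qed.

Lemma condE_mono D S G : condE p D (mono S : _ -> R^o) G =
  p ^+ #|S :&: D| * mono (S :\: D) G.
Proof.
have -> : condE p D (mono S : _ -> R^o) G =
   condE p D (fun H => mono (S :\: D) H * mono (S :&: D) H : R^o) G.
  by apply: eq_condE => H; rewrite -monoU setUC setID.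
rewrite condE_mulr; last by apply: mono_free_of; rewrite -setI_eq0 setIDAC setDE -setIA setICr setI0.
rewrite mulrC; congr (_ * _).
pose g (e : T) (b : bool) : R := if e \in S then b%:R else 1.
rewrite (eq_condE _ _ (g := fun H => \prod_(e in D) g e (e \in H) : R^o)); last first.
  move=> H; rewrite /mono /g big_mkcond [RHS]big_mkcond; apply: eq_bigr => e _.
  by rewrite inE; case: (e \in D); case: (e \in S).
rewrite (condE_prodr p _ g) /g -prodr_const big_mkcond [RHS]big_mkcond /=.
apply: eq_bigr => e _; rewrite inE; case: (e \in D); case: (e \in S) => //=.
- by rewrite mulr1 mulr0 addr0.
- by rewrite !mulr1 addrC subrK.
Qed.

End Monomials.

(** * Which tuples of cliques contribute to a moment *)

Section CliqueParts.
Variables (R : realType) (V : finType) (p : R).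
Hypothesis p01 : 0 <= p <= 1.
Implicit Types (A B N : {set V}) (S D G : {set {set V}}).

Let p0 : 0 <= p. Proof. by case/andP: p01. Qed.
Let p1 : p <= 1. Proof. by case/andP: p01. Qed.

(** The principle behind all vanishing statements: a factor that has mean zero
    over edges on which the other factors do not depend. *)
Lemma E_mul0 S (h k : {set {set V}} -> R) : S \subset edges [set: V] ->
  (forall G, condE p S (h : _ -> R^o) G = 0) -> free_of S k ->
  E p (fun G => h G * k G) = 0.
Proof.
move=> sS h0 kS; rewrite /E.
have -> : edges [set: V] = (edges [set: V] :\: S) :|: S.
  by rewrite setUC setDE setUIr setUCr setIT; apply/esym/setUidPr.
rewrite condE_condE; last by rewrite -setI_eq0 setDE -setIA [_ :&: S]setIC setICr setI0.
rewrite (eq_condE _ _ (g := fun=> 0 : R^o)) ?condE_const // => G.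
rewrite (eq_condE _ _ (g := fun H => k H * h H : R^o)); last by move=> H; rewrite mulrC.
by rewrite condE_mulr // h0 mulr0.
Qed.

Lemma E_tuple0 L (f : {ffun 'I_L -> {set V}}) (h : {set V} -> {set {set V}} -> R) i S :
  S \subset edges [set: V] ->
  (forall G, condE p S (h (f i) : _ -> R^o) G = 0) ->
  (forall j, j != i -> free_of S (h (f j))) ->
  E p (fun G => \prod_j h (f j) G) = 0.
Proof.
move=> sS h0 hf.
rewrite /E (eq_condE _ _ (g := fun G => h (f i) G * \prod_(j | j != i) h (f j) G : R^o)).
  by apply: (@E_mul0 S (h (f i)) (fun G => \prod_(j | j != i) h (f j) G)) => //; apply: prod_free_of.
by move=> G; rewrite (bigD1 i).
Qed.

Lemma edges_sub_all A : edges A \subset edges [set: V].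
Proof. exact: edgesS (subsetT _). Qed.

Lemma edges_disj L (f : {ffun 'I_L -> {set V}}) R0 i j : j != i ->
  edges (f j) :&: edges (f i) \subset edges (f i :&: others R0 f i).
Proof.
move=> ji; rewrite -edgesI setIC setIS //.
by apply: edgesS; apply: subset_trans (subsetUr _ _); apply: (bigcup_sup j).
Qed.

(** The common form of the summands of [X - E X], with [O A] all edges of [A],
    and of those of a centred coefficient, with [O A] the edges of [A] outside
    the block and [a A] a power of [p]. *)
Definition centred (O : {set V} -> {set {set V}}) (a : {set V} -> R) A G : R :=
  a A * (mono R (O A) G - p ^+ #|O A|).

Lemma centred_bound (O : {set V} -> {set {set V}}) (a : {set V} -> R) A G D : O A \subset D -> 0 <= a A -> a A <= p ^+ #|D :\: O A| ->
  `|centred O a A G| <= 2 * \prod_(e in D) ((e \in G)%:R + p).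
Proof.
move=> OD a0 aD.
have -> : \prod_(e in D) ((e \in G)%:R + p) =
   (\prod_(e in D :\: O A) ((e \in G)%:R + p)) * (\prod_(e in O A) ((e \in G)%:R + p)).
  rewrite -[in LHS](setID D (O A)) setUC (eq_bigl [predU (D :\: O A) & (D :&: O A)]); last first.
    by move=> e; rewrite !inE.
  rewrite bigU /=; last by rewrite -setI_eq0 setIC setDE setIACA setICr setI0.
  by rewrite (setIidPr OD).
have h1 : a A <= \prod_(e in D :\: O A) ((e \in G)%:R + p).
  apply: le_trans aD _; rewrite -prodr_const; apply: ler_prod => e _.
  by rewrite p0 lerDr ler0n.
have h2 : p ^+ #|O A| <= \prod_(e in O A) ((e \in G)%:R + p).
  by rewrite -prodr_const; apply: ler_prod => e _; rewrite p0 lerDr ler0n.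
have h3 : mono R (O A) G <= \prod_(e in O A) ((e \in G)%:R + p).
  by apply: ler_prod => e _; rewrite ler0n lerDl.
rewrite /centred normrM (ger0_norm a0) mulrC mulrA [2 * _]mulrC.
rewrite -mulrA [leRHS]mulrC; apply: ler_pM => //.
apply: le_trans (ler_normB _ _) _.
rewrite (ger0_norm (mono_ge0 R (O A) G)).
rewrite (ger0_norm (exprn_ge0 _ p0)).
rewrite mulr_natl mulr2n; exact: lerD.
Qed.

Lemma condE_centred (O : {set V} -> {set {set V}}) (a : {set V} -> R) A G : condE p (O A) (centred O a A : _ -> R^o) G = 0.
Proof.
rewrite /centred condE_mulr // condE_sub condE_const condE_mono setIid setDv /mono big_set0 mulr1.
by rewrite subrr mulr0.
Qed.

(** A set whose random edges are disjoint from those of the others kills the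
    whole product. *)
Lemma E_centred_tuple0 L (f : {ffun 'I_L -> {set V}}) (O : {set V} -> {set {set V}}) (a : {set V} -> R) i :
  (forall A, O A \subset edges A) ->
  (forall j, j != i -> [disjoint O (f j) & O (f i)]) ->
  E p (fun G => \prod_j centred O a (f j) G) = 0.
Proof.
move=> OA dis; apply: (@E_tuple0 _ _ _ i (O (f i))) => [|G|j ji].
- exact: subset_trans (OA _) (edges_sub_all _).
- exact: condE_centred.
- by move=> G G' e; rewrite /centred (mono_free_of R (dis j ji) e).
Qed.

Variable B : {set V}.

Definition inner A := edges (A :&: B).
Definition outer A := edges A :\: edges B.

Lemma innerE A : inner A = edges A :&: edges B.
Proof. by rewrite edgesI. Qed.

Lemma mono_split A G : mono R (edges A) G = mono R (outer A) G * mono R (inner A) G.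
Proof. by rewrite -monoU innerE setUC setID. Qed.

Lemma card_split A : #|edges A| = (#|inner A| + #|outer A|)%N.
Proof. by rewrite innerE cardsID. Qed.

(** The linear part of the clique indicator in the edges of the block: replace
    the product over the inner edges by its expansion to first order around
    [p]. *)
Definition lin A G : R := mono R (outer A) G *
  (p ^+ #|inner A| + \sum_(e in inner A) p ^+ #|inner A|.-1 * ((e \in G)%:R - p)).

Definition quad A G : R := mono R (edges A) G - lin A G.

Lemma disj_outer S : S \subset edges B -> forall A, [disjoint outer A & S].
Proof.
move=> sS A; rewrite -setI_eq0 /outer setIDAC; apply/eqP/setP => e; rewrite !inE.
by case: (boolP (e \in S)) => [/(subsetP sS)|]; rewrite ?inE ?andbF // => ->.
Qed.

Lemma condE_lin A S G : S \subset inner A ->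
  condE p S (lin A : _ -> R^o) G = mono R (outer A) G *
   (p ^+ #|inner A| + \sum_(e in inner A :\: S) p ^+ #|inner A|.-1 * ((e \in G)%:R - p)).
Proof.
move=> sS; rewrite /lin condE_mulr; last first.
  by apply/mono_free_of/disj_outer; apply: subset_trans sS _; rewrite innerE subsetIr.
congr (_ * _); rewrite condE_add condE_const; congr (_ + _).
rewrite condE_sum (big_setID S) /= (setIidPr sS) big1 ?add0r => [|e eS]; last first.
  rewrite condE_mulr // condE_sub condE_const.
  have -> : condE p S (fun H => (e \in H)%:R : R^o) G = p.
    have := condE_mono p S [set e] G; rewrite (setIidPl _) ?sub1set // cards1 expr1.
    rewrite (_ : [set e] :\: S = set0) ?/mono ?big_set0 ?mulr1; last by apply/eqP; rewrite setD_eq0 sub1set.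
    by move=> h; rewrite -[RHS]h; apply: eq_condE => H; rewrite /mono big_set1.
  by rewrite subrr mulr0.
apply: eq_bigr => e; rewrite inE => /andP[eS _]; apply: condE_id.
by move=> H H' hh; rewrite (ind_free_of R eS hh).
Qed.

(** This is the point of taking the best linear approximation: if the inner
    edges are averaged, except for at most one edge [e], then the indicator
    becomes an affine function of [e], and this is what the linear part becomes
    too. Hence a set that meets the others in at most two vertices of the block
    does not contribute. *)
Lemma quad_avg0 A N G : (#|(A :&: B) :&: N| <= 2)%N ->
  condE p (inner A :\: edges N) (quad A : _ -> R^o) G = 0.
Proof.
move=> cN; set S := inner A :\: edges N.
have sS : S \subset inner A by exact: subsetDl.
have sB : S \subset edges B by apply: subset_trans sS _; rewrite innerE subsetIr.
rewrite /quad condE_sub condE_lin //.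
rewrite (eq_condE _ _ (g := fun H => mono R (outer A) H * mono R (inner A) H : R^o)); last first.
  by move=> H; rewrite mono_split.
rewrite condE_mulr; last by apply/mono_free_of/disj_outer.
rewrite -mulrBr; apply/eqP; rewrite mulf_eq0; apply/orP; right.
rewrite condE_mono (setIidPr sS).
have -> : inner A :\: S = edges (A :&: B :&: N).
  by rewrite setDDr setDv set0U edgesI.
have cT : (#|edges (A :&: B :&: N)| <= 1)%N.
  by rewrite card_edges; apply: (@leq_trans 'C(2, 2)) => //; apply: leq_bin2l.
have cI : #|inner A| = (#|edges (A :&: B :&: N)| + #|S|)%N.
  by rewrite -edgesI cardsID.
rewrite cI; move: cT; set U := edges _.
case: (posnP #|U|) => [/cards0_eq -> _|U0 U1].
  by rewrite cards0 add0n /mono !big_set0 mulr1 addr0 subrr.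
have /cards1P[e ->] : #|U| == 1%N by rewrite eqn_leq U1.
rewrite cards1 add1n /mono [X in _ * X]big_set1 [X in _ - (_ + X)]big_set1.
rewrite succnK exprS.
move: ((e \in G)%:R : R) (p ^+ #|S|) => u v.
by apply/eqP; ring.
Qed.

Lemma quad_free_of A D : [disjoint edges A & D] -> free_of D (quad A).
Proof.
move=> dis.
have s1 : [disjoint outer A & D] by apply: disjointWl dis; exact: subsetDl.
have s2 : forall e, e \in inner A -> e \notin D.
  by move=> e; rewrite innerE inE => /andP[eA _]; rewrite (disjointFr dis eA).
move=> G G' e; rewrite /quad /lin (mono_free_of R dis e) (mono_free_of R s1 e).
congr (_ - _ * (_ + _)); apply: eq_bigr => e' /s2 h.
by rewrite (ind_free_of R h e).
Qed.

Lemma E_quad_tuple0 L (f : {ffun 'I_L -> {set V}}) i :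
  (#|(f i :&: others set0 f i) :&: B| <= 2)%N ->
  E p (fun G => \prod_j quad (f j) G) = 0.
Proof.
move=> h; apply: (@E_tuple0 _ _ _ i (inner (f i) :\: edges (others set0 f i))) => [|G|j ji].
- by apply: subset_trans (subsetDl _ _) (edges_sub_all _).
- by apply: quad_avg0; rewrite setIAC.
apply: quad_free_of; rewrite -setI_eq0; apply/eqP/setP => e; rewrite in_set0.
apply/negbTE/negP; rewrite in_setI in_setD innerE in_setI => /andP[ej /andP[eo /andP[ei _]]].
case/negP: eo; have := subsetP (edges_disj f set0 ji) e.
by rewrite in_setI ej ei -edgesI in_setI => /(_ isT)/andP[].
Qed.

(** The linear part has [#|inner A| + 1] terms, each dominated by the product on
    the right, and the indicator itself is one more. *)
Lemma quad_bound A G :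
  `|quad A G| <= (#|edges A|%:R + 2) * \prod_(e in edges A) ((e \in G)%:R + p).
Proof.
set W := \prod_(e in _) _.
have x1 e : (e \in G)%:R <= 1 :> R by case: (e \in G).
have W0 : 0 <= W by apply: prodr_ge0 => e _; rewrite addr_ge0.
have WE : W = (\prod_(e in outer A) ((e \in G)%:R + p)) * (\prod_(e in inner A) ((e \in G)%:R + p)).
  rewrite /W -[in LHS](setID (edges A) (edges B)) setUC.
  rewrite (eq_bigl [predU (outer A) & (edges A :&: edges B)]); last by move=> e; rewrite !inE.
  rewrite bigU /= ?innerE // -setI_eq0 setIC /outer setDE setIACA setICr setI0 //.
have h1 : mono R (outer A) G <= \prod_(e in outer A) ((e \in G)%:R + p).
  by apply: ler_prod => e _; rewrite ler0n lerDl.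
have h2 : p ^+ #|inner A| <= \prod_(e in inner A) ((e \in G)%:R + p).
  by rewrite -prodr_const; apply: ler_prod => e _; rewrite p0 lerDr ler0n.
have h3 : mono R (edges A) G <= W.
  by apply: ler_prod => e _; rewrite ler0n lerDl.
have h4 e : e \in inner A -> `|p ^+ #|inner A|.-1 * ((e \in G)%:R - p)| <= \prod_(e in inner A) ((e \in G)%:R + p).
  move=> ei; rewrite (bigD1 e) //= normrM ger0_norm ?exprn_ge0 // mulrC.
  apply: ler_pM; rewrite ?exprn_ge0 //.
    by apply: le_trans (ler_normB _ _) _; rewrite (ger0_norm p0) (ger0_norm (ler0n _ _)).
  rewrite (cardD1 e) ei /= -prodr_const.
  rewrite (eq_bigl (fun i => (i \in inner A) && (i != e))); last by move=> i; rewrite !inE andbC.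
  by apply: ler_prod => i _; rewrite p0 lerDr ler0n.
apply: le_trans (ler_normB _ _) _.
rewrite (ger0_norm (mono_ge0 _ _ _)) /lin normrM (ger0_norm (mono_ge0 _ _ _)).
apply: le_trans (_ : W + (\prod_(e in outer A) ((e \in G)%:R + p)) *
   ((1 + #|inner A|%:R) * \prod_(e in inner A) ((e \in G)%:R + p)) <= _).
  apply: lerD h3 _; apply: ler_pM; rewrite ?mono_ge0 //.
  apply: le_trans (ler_normD _ _) _; rewrite mulrDl mul1r; apply: lerD.
    by rewrite ger0_norm ?exprn_ge0.
  apply: le_trans (ler_norm_sum _ _ _) _.
  by rewrite mulr_natl -sumr_const; apply: ler_sum.
rewrite mulrCA -WE -[X in X + _]mul1r -mulrDl ler_wpM2r //.
rewrite addrA (_ : 1 + 1 = 2) // addrC lerD2r ler_nat innerE.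
by rewrite subset_leq_card ?subsetIl.
Qed.

Variable r : nat.

(** The coefficient of the indicator of [e] when the linear parts of all cliques
    are added up, and the part of that sum which depends only on the edges
    outside the block. *)
Definition coef e G : R :=
  \sum_(A : {set V} | (#|A| == r) && (e \in edges A)) p ^+ #|inner A|.-1 * mono R (outer A) G.

Definition base G : R :=
  \sum_(A : {set V} | #|A| == r) mono R (outer A) G *
     (p ^+ #|inner A| - \sum_(e in inner A) p ^+ #|inner A|.-1 * p).

Lemma sum_linE G : \sum_(A : {set V} | #|A| == r) lin A G =
  base G + \sum_(e in edges B) coef e G * (e \in G)%:R.
Proof.
have -> : \sum_(e in edges B) coef e G * (e \in G)%:R =
  \sum_(A : {set V} | #|A| == r) \sum_(e in inner A) p ^+ #|inner A|.-1 * mono R (outer A) G * (e \in G)%:R.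
  under eq_bigr => e _ do rewrite mulr_suml.
  rewrite (exchange_big_dep (fun A : {set V} => #|A| == r)) /=; last by move=> e A _ /andP[].
  apply: eq_bigr => A rA; apply: eq_bigl => e; rewrite innerE in_setI rA /=.
  by rewrite andbC.
rewrite /base -big_split; apply: eq_bigr => A _ /=.
have -> : lin A G = mono R (outer A) G * (p ^+ #|inner A| +
   (\sum_(e in inner A) p ^+ #|inner A|.-1 * (e \in G)%:R -
    \sum_(e in inner A) p ^+ #|inner A|.-1 * p)).
  by rewrite /lin -sumrB; congr (_ * (_ + _)); apply: eq_bigr => e _; rewrite mulrBr.
have -> : \sum_(e in inner A) p ^+ #|inner A|.-1 * mono R (outer A) G * (e \in G)%:R =
   mono R (outer A) G * \sum_(e in inner A) p ^+ #|inner A|.-1 * (e \in G)%:R.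
  by rewrite mulr_sumr; apply: eq_bigr => e _; rewrite mulrA [mono _ _ _ * _]mulrC.
rewrite -mulrDr; congr (_ * _).
by rewrite -addrA; congr (_ + _); rewrite addrC.
Qed.

Lemma outer_free A : free_of (edges B) (mono R (outer A)).
Proof. by apply/mono_free_of/disj_outer. Qed.

Lemma coef_free e : free_of (edges B) (coef e).
Proof.
move=> G G' h; apply: eq_bigr => A _.
by rewrite (@outer_free A _ _ h).
Qed.

Lemma base_free : free_of (edges B) base.
Proof.
move=> G G' h; apply: eq_bigr => A _.
by rewrite (@outer_free A _ _ h).
Qed.

End CliqueParts.

(** * Cliques of the random graph as monomials *)

Section Link.
Variables (R : realType) (n : nat) (p : R).

Lemma potential_edgesE : potential_edges n = edges [set: 'I_n].
Proof. by apply/setP => e; rewrite !inE subsetT andbT. Qed.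

Lemma gnp_expectationE (V : lmodType R) (f : {set {set 'I_n}} -> V) :
  gnp_expectation p f = condE p (edges [set: 'I_n]) f set0.
Proof.
rewrite /gnp_expectation /graphs potential_edgesE; apply: eq_bigr => G _.
by rewrite set0D set0U /gnp_prob potential_edgesE.
Qed.

Lemma is_cliqueE (G : {set {set 'I_n}}) A : is_clique G A = (edges A \subset G).
Proof.
apply/forall_inP/subsetP => [H e|H x xA].
  rewrite inE => /andP[/cards2P[x [y [xy ->]]]]; rewrite subUset !sub1set => /andP[xA yA].
  by have /forall_inP/(_ y yA)/implyP/(_ xy) := H x xA.
apply/forall_inP => y yA; apply/implyP => xy; apply: H.
by rewrite inE cards2 xy eqxx /= subUset !sub1set xA.
Qed.

Lemma clique_countE r (G : {set {set 'I_n}}) :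
  (clique_count r G)%:R = \sum_(A : {set 'I_n} | #|A| == r) mono R (edges A) G.
Proof.
rewrite /clique_count -sum1_card natr_sum.
rewrite (eq_bigl (fun A : {set 'I_n} => (#|A| == r) && is_clique G A)); last first.
  by move=> A; rewrite inE.
rewrite big_mkcondr; apply: eq_bigr => A _.
by rewrite monoE is_cliqueE; case: (edges A \subset G).
Qed.

End Link.

(** * The expected number of cliques of each size *)

Lemma bin2_double a : (2 * 'C(a, 2) = a * a.-1)%N.
Proof. by rewrite -mul_bin_diag bin1. Qed.

(** The arithmetic behind [cost_quad], with [a], [b] the two overlaps of a
    clique, [u], [v] their parts inside the block, and [k] the number of
    vertices of the clique in the block. When the two overlaps are not jointly
    large, at least three of the block vertices counted in the two revelations
    are new. *)
Lemma small_overlaps (a b u v k : nat) : (u <= a -> v <= b -> u <= k -> v <= k ->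
  3 <= u + v -> 3 <= k -> ~~ [&& 0 < a, 0 < b & 4 <= a + b] ->
  [\/ a = 0 /\ 3 <= b, b = 0 /\ 3 <= a, a = 1 /\ b = 2 | a = 2 /\ b = 1]
  /\ 3 <= (k - u) + (k - v))%N.
Proof.
move=> ua vb uk vk uv k3; rewrite !negb_and => h.
have {h} h : (a = 0 \/ b = 0 \/ a + b < 4)%N by case/or3P: h; lia.
split; last by lia.
have : ((a = 0 /\ 3 <= b) \/ (b = 0 /\ 3 <= a) \/ (a = 1 /\ b = 2) \/ (a = 2 /\ b = 1))%N by lia.
by case=> [|[|[|]]] ?; [constructor 1|constructor 2|constructor 3|constructor 4].
Qed.

Section CliqueScale.
Variables (R : realType) (x p Lam : R) (r : nat).
Hypotheses (p0 : 0 < p) (p1 : p <= 1) (L1 : 1 <= Lam)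
  (HL : Lam ^+ 2 <= x ^+ 2 * p ^+ r.+1) (x0 : 0 < x) (r1 : (0 < r)%N).

(** The order of the expected number of cliques on [a] of [x] vertices. By
    [HL], its values for [3 <= a <= r] exceed the value at 2 by at least the
    factor [Lam]. *)
Definition clique_scale a : R := x ^+ a * p ^+ 'C(a, 2).

Lemma clique_scale_gt0 a : 0 < clique_scale a.
Proof. by rewrite mulr_gt0 // exprn_gt0. Qed.

Lemma Lam_le_xp : Lam <= x * p.
Proof.
have L0 : 0 <= Lam by apply: le_trans L1.
have : Lam ^+ 2 <= (x * p) ^+ 2.
  apply: le_trans HL _; rewrite exprMn ler_pM2l ?exprn_gt0 //.
  by apply: ler_wiXn2l => //; apply: ltW.
by rewrite ler_pXn2r // nnegrE mulr_ge0 // ltW.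
Qed.

Lemma Lam_le_x : Lam <= x.
Proof. by apply: le_trans Lam_le_xp _; rewrite ger_pMr. Qed.

Lemma x_ge1 : 1 <= x. Proof. exact: le_trans Lam_le_x. Qed.
Lemma clique_scale0 : clique_scale 0 = 1. Proof. by rewrite /clique_scale !expr0 mulr1. Qed.
Lemma clique_scale1 : clique_scale 1 = x. Proof. by rewrite /clique_scale expr1 expr0 mulr1. Qed.
Lemma clique_scale2 : clique_scale 2 = x ^+ 2 * p. Proof. by rewrite /clique_scale expr1. Qed.

(** Squared and divided by [(x^2 p)^2], the left side is [Lam^2] and the right
    side is [(x^2 p^(a + 1))^(a - 2)], a positive power of a number that is at
    least [x^2 p^(r + 1)]. *)
Lemma clique_scale_gain a : (3 <= a <= r)%N -> x ^+ 2 * p * Lam <= clique_scale a.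
Proof.
case: a => [|[|m]] // /andP[m1 mr].
have L0 : 0 <= Lam by apply: le_trans L1.
have e1 : clique_scale m.+2 ^+ 2 = (x ^+ 2 * p) ^+ 2 * (x ^+ 2 * p ^+ m.+3) ^+ m.
  have e : (p ^+ 'C(m.+2, 2)) ^+ 2 = p ^+ 2 * (p ^+ m.+3) ^+ m.
    by rewrite -!exprM -exprD mulnC bin2_double /=; congr (_ ^+ _); lia.
  have e' : (x ^+ m.+2) ^+ 2 = x ^+ 4 * (x ^+ 2) ^+ m.
    by rewrite -!exprM -exprD; congr (_ ^+ _); lia.
  rewrite /clique_scale exprMn e e' [(x ^+ 2 * p ^+ m.+3) ^+ m]exprMn.
  move: ((x ^+ 2) ^+ m) ((p ^+ m.+3) ^+ m) => u v; ring.
have h : Lam ^+ 2 <= (x ^+ 2 * p ^+ m.+3) ^+ m.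
  have h1 : Lam ^+ 2 <= x ^+ 2 * p ^+ m.+3.
    apply: le_trans HL _; rewrite ler_pM2l ?exprn_gt0 //.
    by apply: ler_wiXn2l => //; exact: ltW.
  have h2 : 1 <= x ^+ 2 * p ^+ m.+3 by apply: le_trans h1; rewrite exprn_ege1.
  exact: le_trans h1 (ler_eXnr m1 h2).
have hh : (x ^+ 2 * p * Lam) ^+ 2 <= clique_scale m.+2 ^+ 2.
  by rewrite e1 exprMn ler_pM2l // exprn_gt0 // mulr_gt0 // exprn_gt0.
have l0 : 0 <= x ^+ 2 * p * Lam by rewrite mulr_ge0 // mulr_ge0 ?exprn_ge0 // ltW.
by move: hh; rewrite ler_pXn2r // nnegrE // ltW // clique_scale_gt0.
Qed.

Lemma x2p_ge1 : 1 <= x ^+ 2 * p.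
Proof.
rewrite expr2 -mulrA; apply: mulr_ege1; first exact: x_ge1.
exact: le_trans L1 Lam_le_xp.
Qed.

Lemma clique_scale_gex2p a : (2 <= a <= r)%N -> x ^+ 2 * p <= clique_scale a.
Proof.
case/andP => a2 ar; case: (ltngtP a 2) a2 => // [a3|->] _; last by rewrite clique_scale2.
apply: le_trans (clique_scale_gain _); rewrite ?a3 //.
by rewrite ler_peMr // (le_trans _ x2p_ge1).
Qed.

Lemma clique_scale_gex a : (a <= r)%N -> (0 < a)%N -> x <= clique_scale a.
Proof.
case: a => // -[_ _|a ar _]; first by rewrite clique_scale1.
apply: le_trans (clique_scale_gex2p _) => //; rewrite expr2 -mulrA ler_peMr // ?(ltW x0) //.
exact: le_trans L1 Lam_le_xp.
Qed.

Lemma clique_scale_ge1 a : (a <= r)%N -> 1 <= clique_scale a.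
Proof.
case: a => [_|a ar]; first by rewrite clique_scale0.
exact: le_trans x_ge1 (clique_scale_gex ar _).
Qed.

Lemma clique_scale_pair2 a b : (a <= r)%N -> (b <= r)%N -> (2 <= a + b)%N ->
  x ^+ 2 * p <= clique_scale a * clique_scale b.
Proof.
have x2p0 : 0 <= x ^+ 2 * p by apply: le_trans x2p_ge1.
wlog ab : a b / (a <= b)%N => [W ar br h|].
  have [ab|/ltnW ba] := leqP a b; first exact: W.
  by rewrite [leRHS]mulrC; apply: W => //; rewrite addnC.
move=> ar br h; case: a ab ar h => [|[|a]] ab ar h.
- by rewrite clique_scale0 mul1r clique_scale_gex2p // br andbT.
- rewrite clique_scale1 expr2 -mulrA ler_pM2l //.
  by apply: le_trans (clique_scale_gex br _); rewrite ?ger_pMr.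
- rewrite -[leLHS]mulr1; apply: ler_pM => //.
    by apply: clique_scale_gex2p.
  exact: clique_scale_ge1.
Qed.

Lemma clique_scale_pair3 a b : (a <= r)%N -> (b <= r)%N -> (2 <= a)%N -> (2 <= b)%N ->
  (3 <= a)%N || (3 <= b)%N -> (x ^+ 2 * p) ^+ 2 * Lam <= clique_scale a * clique_scale b.
Proof.
have x2p0 : 0 <= x ^+ 2 * p by apply: le_trans x2p_ge1.
have L0 : 0 <= Lam by apply: le_trans L1.
have E3 : (x ^+ 2 * p) ^+ 2 * Lam = (x ^+ 2 * p * Lam) * (x ^+ 2 * p) by ring.
have l0 : 0 <= x ^+ 2 * p * Lam by exact: mulr_ge0.
move=> ar br a2 b2 /orP[a3|b3]; rewrite E3.
- apply: ler_pM => //; first by apply: clique_scale_gain; rewrite a3.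
  by apply: clique_scale_gex2p; rewrite b2.
- rewrite mulrC; apply: ler_pM => //; first by apply: clique_scale_gex2p; rewrite a2.
  by apply: clique_scale_gain; rewrite b3.
Qed.

Lemma clique_scale_pair4 a b : (a <= r)%N -> (b <= r)%N -> (0 < a)%N -> (0 < b)%N -> (4 <= a + b)%N ->
  x ^+ 3 * p * Lam <= clique_scale a * clique_scale b.
Proof.
have x2p0 : 0 <= x ^+ 2 * p by apply: le_trans x2p_ge1.
have L0 : 0 <= Lam by apply: le_trans L1.
have l0 : 0 <= x ^+ 2 * p * Lam by exact: mulr_ge0.
have E3 : x ^+ 3 * p * Lam = x * (x ^+ 2 * p * Lam) by ring.
move=> ar br a1 b1 ab.
have [a3|a2] := leqP 3 a.
  rewrite E3 mulrC; apply: ler_pM; rewrite ?l0 ?(ltW x0) //.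
    by apply: clique_scale_gain; rewrite a3.
  exact: clique_scale_gex.
have [b3|b2] := leqP 3 b.
  rewrite E3; apply: ler_pM; rewrite ?l0 ?(ltW x0) //.
    exact: clique_scale_gex.
  by apply: clique_scale_gain; rewrite b3.
have -> : a = 2%N by lia.
have -> : b = 2%N by lia.
rewrite clique_scale2 (_ : x ^+ 2 * p * (x ^+ 2 * p) = x ^+ 3 * p * (x * p)); last by ring.
by rewrite ler_pM2l ?mulr_gt0 ?exprn_gt0 // Lam_le_xp.
Qed.

End CliqueScale.

(** * Costs for cliques meeting a block of vertices *)

Section Costs.
Variables (R : realType) (n r : nat) (p Lam : R).
Let x : R := n%:R.
Hypotheses (p0 : 0 < p) (p1 : p <= 1) (L1 : 1 <= Lam)
  (HL : Lam ^+ 2 <= x ^+ 2 * p ^+ r.+1) (n0 : (0 < n)%N) (r1 : (1 < r)%N).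
Local Notation V := 'I_n.
Implicit Types A B S : {set V}.
Let x0 : 0 < x. Proof. by rewrite ltr0n. Qed.
Let r0 : (0 < r)%N. Proof. exact: ltnW. Qed.
Let p01 : 0 <= p <= 1. Proof. by rewrite ltW. Qed.
Local Notation G := (clique_scale x p).
Local Notation D := 'C(r, 2).

(** A vertex of the block has only [#|B|] choices. Giving it the weight
    [1 / #|B|] instead of [1 / n] keeps the total weight bounded and makes new
    block vertices cheap. *)
Definition block_weight B (v : V) : R := if v \in B then (#|B|%:R)^-1 else x^-1.

Lemma block_weight_gt0 B v : 0 < block_weight B v.
Proof.
rewrite /block_weight; case: ifP => vB; rewrite invr_gt0 // ltr0n.
by apply/card_gt0P; exists v.
Qed.

Lemma sum_block_weight B : \sum_v block_weight B v <= 2.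
Proof.
rewrite (bigID (mem B)) /= (eq_bigr (fun=> (#|B|%:R)^-1)); last by rewrite /block_weight => v /= ->.
rewrite [X in _ + X](eq_bigr (fun=> x^-1)); last by rewrite /block_weight => v /= /negbTE ->.
rewrite !sumr_const -[X in X + _]mulr_natr -[X in _ + X]mulr_natr (_ : 2 = 1 + 1) //.
apply: lerD.
  case: (posnP #|B|) => [->|B0]; first by rewrite mulr0.
  by rewrite mulVf // pnatr_eq0 -lt0n.
rewrite mulrC ler_pdivrMr // mul1r ler_nat.
by apply: leq_trans (max_card _) _; rewrite card_ord.
Qed.

Definition beta B : R := #|B|%:R / x.

Lemma costE B A S : #|A| = r ->
  cost p (block_weight B) A S * G #|A :&: S| =
  x ^+ r * p ^+ D * beta B ^+ (#|A :&: B| - #|A :&: B :&: S|).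
Proof.
move=> rA.
have ar : (#|A :&: S| <= r)%N by rewrite -rA subset_leq_card ?subsetIl.
rewrite /cost /clique_scale rA.
have e2 : p ^+ D = p ^+ (D - 'C(#|A :&: S|, 2)) * p ^+ 'C(#|A :&: S|, 2).
  by rewrite -exprD subnK //; apply: leq_bin2l.
have -> : \prod_(v in A :\: S) (block_weight B v)^-1 = x ^+ #|A :\: S| * beta B ^+ #|(A :&: B) :\: S|.
  rewrite -!prodr_const.
  rewrite [X in _ * X](_ : _ = \prod_(v in A :\: S) if v \in B then beta B else 1).
    rewrite -big_split; apply: eq_bigr => v _ /=; rewrite /block_weight /beta.
    by case: (v \in B); rewrite invrK ?mulr1 // mulrC mulfVK // gt_eqF.
  rewrite -big_mkcondr; apply: eq_bigl => v; rewrite !inE.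
  by case: (v \in S); case: (v \in A).
have -> : #|A :&: B :\: S| = (#|A :&: B| - #|A :&: B :&: S|)%N by rewrite cardsD.
have e : x ^+ r = x ^+ #|A :\: S| * x ^+ #|A :&: S|.
  by rewrite -exprD -rA addnC cardsID.
by rewrite e e2; ring.
Qed.

(** By [costE], a cost is [x^r p^D], divided by the scale of the known part and
    multiplied by one factor [beta B] for each new vertex in the block. It
    remains to give lower bounds for the product of the two scales and for the
    total number of these factors. *)
Lemma cost_cost B A S1 S2 gam i : #|A| = r -> beta B <= 1 -> 0 < gam ->
  gam <= G #|A :&: S1| * G #|A :&: S2| ->
  (i <= (#|A :&: B| - #|A :&: B :&: S1|) + (#|A :&: B| - #|A :&: B :&: S2|))%N ->
  cost p (block_weight B) A S1 * cost p (block_weight B) A S2 <= (x ^+ r * p ^+ D) ^+ 2 * beta B ^+ i / gam.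
Proof.
move=> rA b1 g0 gG ik.
have b0 : 0 <= beta B by rewrite divr_ge0.
have c0 : 0 <= cost p (block_weight B) A S1 * cost p (block_weight B) A S2.
  by rewrite mulr_ge0 // cost_ge0 // => v; exact: block_weight_gt0.
rewrite ler_pdivlMr //; apply: le_trans (ler_wpM2l c0 gG) _.
rewrite mulrACA !costE // mulrACA -expr2 -exprD.
rewrite ler_pM2l ?exprn_gt0 ?mulr_gt0 ?exprn_gt0 //.
exact: ler_wiXn2l.
Qed.

(** The orders of magnitude of the expected number of cliques, of its standard
    deviation and of the coefficient of one edge. *)
Definition clique_mass : R := x ^+ r * p ^+ D.
Definition sd_scale : R := clique_mass / (x * Num.sqrt p).
Definition coef_scale : R := clique_mass / (x ^+ 2 * p).

Lemma clique_mass_gt0 : 0 < clique_mass. Proof. by rewrite mulr_gt0 // exprn_gt0. Qed.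
Lemma sqrtp_gt0 : 0 < Num.sqrt p. Proof. by rewrite sqrtr_gt0. Qed.
Lemma sd_scale_gt0 : 0 < sd_scale.
Proof. by rewrite divr_gt0 ?clique_mass_gt0 // mulr_gt0 // sqrtp_gt0. Qed.
Lemma coef_scale_gt0 : 0 < coef_scale.
Proof. by rewrite divr_gt0 ?clique_mass_gt0 // mulr_gt0 // exprn_gt0. Qed.

Lemma sd_scale_sq : sd_scale ^+ 2 = clique_mass ^+ 2 / (x ^+ 2 * p).
Proof. by rewrite /sd_scale expr_div_n [(x * _) ^+ 2]exprMn sqr_sqrtr // ltW. Qed.

Lemma cardI_le A S : #|A| = r -> (#|A :&: S| <= r)%N.
Proof. by move=> <-; rewrite subset_leq_card ?subsetIl. Qed.

Lemma cardIU_le A S1 S2 : (#|A :&: (S1 :|: S2)| <= #|A :&: S1| + #|A :&: S2|)%N.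
Proof. by rewrite setIUr leq_card_setU. Qed.

Lemma beta_set0 : beta set0 <= 1.
Proof. by rewrite /beta cards0 mul0r. Qed.

Lemma cost_var A S1 S2 : #|A| = r -> (2 <= #|A :&: (S1 :|: S2)|)%N ->
  cost p (block_weight set0) A S1 * cost p (block_weight set0) A S2 <= sd_scale ^+ 2.
Proof.
move=> rA c2; rewrite sd_scale_sq.
have := @cost_cost set0 A S1 S2 (x ^+ 2 * p) 0 rA beta_set0.
rewrite expr0 mulr1; apply => //; first by rewrite mulr_gt0 // exprn_gt0.
apply: (clique_scale_pair2 p0 p1 L1 HL) => //; try exact: cardI_le.
exact: leq_trans c2 (cardIU_le _ _ _).
Qed.

(** Both overlaps contain [e], and if both were equal to [e] then so would be
    the overlap with their union. *)
Lemma cost_coef (e : {set V}) A S1 S2 : #|A| = r -> #|e| = 2%N -> e \subset A ->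
  e \subset S1 -> e \subset S2 -> (3 <= #|A :&: (S1 :|: S2)|)%N ->
  cost p (block_weight set0) A S1 * cost p (block_weight set0) A S2 <= (coef_scale / Num.sqrt Lam) ^+ 2.
Proof.
move=> rA e2 eA e1 eS2 c3.
have L0 : 0 < Lam by apply: lt_le_trans L1.
have g0 : 0 < x ^+ 2 * p by rewrite mulr_gt0 // exprn_gt0.
rewrite expr_div_n sqr_sqrtr ?(ltW L0) // /coef_scale expr_div_n -mulrA -invfM.
have := @cost_cost set0 A S1 S2 ((x ^+ 2 * p) ^+ 2 * Lam) 0 rA beta_set0.
rewrite expr0 mulr1; apply => //; first by rewrite mulr_gt0 // exprn_gt0.
have a2 S : e \subset S -> (2 <= #|A :&: S|)%N.
  by move=> eS; rewrite -e2 subset_leq_card // subsetI eA.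
apply: (clique_scale_pair3 p0 p1 L1 HL) => //; try exact: cardI_le; try exact: a2.
(* Otherwise both overlaps have exactly two vertices, so they equal [e]. *)
case: (ltngtP #|A :&: S1| 2) (a2 _ e1) => // h1 _.
case: (ltngtP #|A :&: S2| 2) (a2 _ eS2) => // h2 _.
have E1 : A :&: S1 = e by apply/esym/eqP; rewrite eqEcard subsetI eA e1 e2 h1.
have E2 : A :&: S2 = e by apply/esym/eqP; rewrite eqEcard subsetI eA eS2 e2 h2.
by move: c3; rewrite setIUr E1 E2 setUid e2.
Qed.

(** Either both overlaps are nonempty with at least four vertices in total, and
    then the two scales multiply to more than [x^2 p] by the factor [x Lam];
    or the scales give only the factor [Lam], but there are three factors
    [beta B]. The two hypotheses on [th] are what these two cases need. *)
Lemma cost_quad B (t th : R) A S1 S2 : #|A| = r -> 0 < t -> beta B <= 1 ->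
  t ^+ 2 * beta B ^+ 3 <= th ^+ 2 * Lam -> t ^+ 2 <= th ^+ 2 * (x * Lam) ->
  (3 <= #|A :&: (S1 :|: S2) :&: B|)%N ->
  cost p (block_weight B) A S1 * cost p (block_weight B) A S2 <= (sd_scale * th / t) ^+ 2.
Proof.
move=> rA t0 b1 H1 H2 c3.
have L0 : 0 < Lam by apply: lt_le_trans L1.
have g0 : 0 < x ^+ 2 * p by rewrite mulr_gt0 // exprn_gt0.
have Y20 : 0 < clique_mass ^+ 2 by rewrite exprn_gt0 // clique_mass_gt0.
have b0 : 0 <= beta B by rewrite divr_ge0.
have t20 : 0 < t ^+ 2 by rewrite exprn_gt0.
have k1 S : (#|A :&: B :&: S| <= #|A :&: S|)%N.
  by rewrite subset_leq_card // setSI // subsetIl.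
have k2 S : (#|A :&: B :&: S| <= #|A :&: B|)%N by rewrite subset_leq_card // subsetIl.
have k3 : (3 <= #|A :&: B :&: S1| + #|A :&: B :&: S2|)%N.
  by apply: leq_trans c3 _; rewrite setIAC; exact: cardIU_le.
have k4 : (3 <= #|A :&: B|)%N.
  by apply: leq_trans c3 _; rewrite setIAC subset_leq_card // subsetIl.
have fin gam i : 0 < gam ->
    gam <= G #|A :&: S1| * G #|A :&: S2| ->
    (i <= (#|A :&: B| - #|A :&: B :&: S1|) + (#|A :&: B| - #|A :&: B :&: S2|))%N ->
    t ^+ 2 * beta B ^+ i * (x ^+ 2 * p) <= th ^+ 2 * gam ->
    cost p (block_weight B) A S1 * cost p (block_weight B) A S2 <= (sd_scale * th / t) ^+ 2.
  move=> gam0 gG ik h; apply: le_trans (cost_cost rA b1 gam0 gG ik) _.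
  have -> : (sd_scale * th / t) ^+ 2 = clique_mass ^+ 2 / (x ^+ 2 * p) * th ^+ 2 / t ^+ 2.
    by rewrite -sd_scale_sq; move: sd_scale => z; rewrite -exprMn -expr_div_n.
  rewrite -/clique_mass.
  rewrite ler_pdivrMr //.
  have -> : clique_mass ^+ 2 / (x ^+ 2 * p) * th ^+ 2 / t ^+ 2 * gam =
     clique_mass ^+ 2 * (th ^+ 2 * gam / (t ^+ 2 * (x ^+ 2 * p))).
    by rewrite [in RHS]invfM; move: (_^-1) (_^-1) (clique_mass ^+ 2) => *; ring.
  rewrite ler_pM2l // ler_pdivlMr ?mulr_gt0 //.
  by apply: le_trans h; rewrite mulrCA mulrA.
have [h4|h4] := boolP [&& (0 < #|A :&: S1|)%N, (0 < #|A :&: S2|)%N & (4 <= #|A :&: S1| + #|A :&: S2|)%N].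
  case/and3P: h4 => q1 q2 q3.
  apply: (fin (x ^+ 3 * p * Lam) 0%N) => //.
  - by rewrite !mulr_gt0 // exprn_gt0.
  - by apply: (clique_scale_pair4 p0 p1 L1 HL) => //; exact: cardI_le.
  - rewrite expr0 mulr1 (_ : th ^+ 2 * _ = th ^+ 2 * (x * Lam) * (x ^+ 2 * p)); last by ring.
    by rewrite ler_pM2r.
have [h5 h6] := small_overlaps (k1 S1) (k1 S2) (k2 S1) (k2 S2) k3 k4 h4.
apply: (fin (x ^+ 2 * p * Lam) 3%N) => //.
- by rewrite !mulr_gt0 // exprn_gt0.
- have G3 c : (3 <= c <= r)%N -> x ^+ 2 * p * Lam <= G c by exact: (clique_scale_gain p0 p1 L1 HL).
  have LX := Lam_le_x p0 p1 L1 HL x0 r0.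
  have X3 : x ^+ 2 * p * Lam <= x * (x ^+ 2 * p) by rewrite mulrC ler_pM2r.
  case: h5 => -[].
  + by move=> -> b3; rewrite clique_scale0 mul1r; apply: G3; rewrite b3 cardI_le.
  + by move=> -> a3; rewrite clique_scale0 mulr1; apply: G3; rewrite a3 cardI_le.
  + by move=> -> ->; rewrite clique_scale1 clique_scale2.
  + by move=> -> ->; rewrite clique_scale1 clique_scale2 [leRHS]mulrC.
- rewrite (_ : th ^+ 2 * _ = th ^+ 2 * Lam * (x ^+ 2 * p)); last by ring.
  by rewrite ler_pM2r.
Qed.

End Costs.

(** * Counting cliques through an edge *)

Lemma leq_pow m k e : (m <= k)%N -> (m ^ e <= k ^ e)%N.
Proof. by case: e => // e mk; rewrite leq_exp2r. Qed.

Lemma half_sub (R : realType) (u : R) : u - 1 / 2 * u = u / 2.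
Proof. lra. Qed.

Lemma ffact_ge m k : ((m - k) ^ k <= m ^_ k)%N.
Proof.
rewrite ffact_prod -[X in (_ ^ X <= _)%N](card_ord k) -prod_nat_const.
by apply: leq_prod => i _; have := ltn_ord i; lia.
Qed.

Lemma ffact_le m k : (m ^_ k <= m ^ k)%N.
Proof.
rewrite ffact_prod -[X in (_ <= _ ^ X)%N](card_ord k) -prod_nat_const.
by apply: leq_prod => i _; exact: leq_subr.
Qed.

(** Removing [e] is a bijection onto the subsets of its complement. *)
Lemma card_supersets (V : finType) (e : {set V}) r : (#|e| <= r)%N ->
  #|[set A : {set V} | (#|A| == r) && (e \subset A)]| = 'C(#|V| - #|e|, r - #|e|).
Proof.
move=> er; have -> : (#|V| - #|e|)%N = #|~: e| by rewrite -(cardsC e) addKn.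
rewrite -cards_draws.
rewrite -(card_in_imset (f := fun A : {set V} => A :\: e)); last first.
  move=> A A'; rewrite !inE => /andP[_ eA] /andP[_ eA'] h.
  by rewrite -(setID A e) -(setID A' e) h (setIidPr eA) (setIidPr eA').
apply: eq_card => C; rewrite !inE; apply/imsetP/andP => [[A]|[Ce cC]].
  rewrite inE => /andP[/eqP cA eA] ->; split; first by rewrite setDE subsetIr.
  by rewrite cardsD (setIidPr eA) cA.
have de : [disjoint C & e] by rewrite disjoints_subset.
exists (C :|: e); last first.
  rewrite setDUl setDv setU0; apply/esym/eqP; rewrite eqEsubset subsetDl /=.
  by rewrite subsetD subxx de.
rewrite inE subsetUr andbT cardsU (_ : C :&: e = set0) ?cards0 ?subn0.
  by rewrite (eqP cC) subnK.
by apply/eqP; rewrite setI_eq0.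
Qed.

Section Counting.
Variables (R : realType) (n r : nat).
Let x : R := n%:R.
Hypotheses (n0 : (0 < n)%N) (r1 : (1 < r)%N).
Local Notation V := 'I_n.
Implicit Types A B S : {set V}.
Let x0 : 0 < x. Proof. by rewrite ltr0n. Qed.
Local Notation D := 'C(r, 2).

(** A lower bound for C(n - 2, r - 2) / n^(r - 2) once [2 * r <= n]. *)
Definition count_const : R := (2 ^+ (r - 2) * (r - 2)`!%:R)^-1.

Lemma count_const_gt0 : 0 < count_const.
Proof. by rewrite invr_gt0 mulr_gt0 ?exprn_gt0 // ltr0n fact_gt0. Qed.

Lemma bin_lower : (2 * r <= n)%N -> count_const * x ^+ (r - 2) <= 'C(n - 2, r - 2)%:R.
Proof.
move=> rn; rewrite mulrC ler_pdivrMr ?mulr_gt0 ?exprn_gt0 ?ltr0n ?fact_gt0 //.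
rewrite mulrCA -natrM bin_ffact -natrX -natrX -natrM ler_nat.
apply: leq_trans (_ : 2 ^ (r - 2) * (n - r) ^ (r - 2) <= _)%N.
  by rewrite -expnMn; apply: leq_pow; lia.
rewrite leq_mul2l; apply/orP; right.
by apply: leq_trans (ffact_ge _ _); rewrite (_ : n - 2 - (r - 2) = n - r)%N //; lia.
Qed.

Lemma bin_upper : 'C(n - 2, r - 2)%:R <= x ^+ (r - 2).
Proof.
rewrite -natrX ler_nat; apply: leq_trans (_ : 'C(n - 2, r - 2) * (r - 2)`! <= _)%N.
  by rewrite leq_pmulr // fact_gt0.
rewrite bin_ffact; apply: leq_trans (ffact_le _ _) _.
by apply: leq_pow; exact: leq_subr.
Qed.

Lemma D_gt0 : (0 < D)%N. Proof. by rewrite bin_gt0. Qed.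

Variable p : R.
Hypothesis p0 : 0 < p.
Local Notation mu0 := (coef_scale n r p).

Definition coef_mean B e : R := \sum_(A : {set V} | (#|A| == r) && (e \in edges A))
   p ^+ #|inner B A|.-1 * p ^+ #|outer B A|.

Lemma coef_meanE B e : e \in edges B -> coef_mean B e = 'C(n - 2, r - 2)%:R * p ^+ D.-1.
Proof.
move=> eB; have e2 : #|e| = 2%N by move: eB; rewrite inE => /andP[/eqP].
rewrite /coef_mean (eq_bigr (fun=> p ^+ D.-1)); last first.
  move=> A /andP[/eqP rA eA]; rewrite -exprD; congr (_ ^+ _).
  have := card_split B A; rewrite card_edges rA => ->.
  have : (0 < #|inner B A|)%N by apply/card_gt0P; exists e; rewrite innerE inE eA eB.
  by case: #|inner B A|.
rewrite sumr_const -[LHS]mulr_natl; congr (_%:R * _).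
have := @card_supersets _ e r; rewrite e2 card_ord => <- //.
by apply: eq_card => A; rewrite [in RHS]inE -[LHS]/((#|A| == r) && (e \in edges A)) [in LHS]inE e2.
Qed.

Lemma coef_scaleE : mu0 = x ^+ (r - 2) * p ^+ D.-1.
Proof.
have gx : x != 0 by rewrite gt_eqF.
have gp : p != 0 by rewrite gt_eqF.
have xr : x ^+ r = x ^+ 2 * x ^+ (r - 2) by rewrite -exprD subnKC.
have pD : p ^+ D = p * p ^+ D.-1 by rewrite -exprS prednK // D_gt0.
rewrite /coef_scale /clique_mass -/x xr pD.
by move: (x ^+ (r - 2)) (p ^+ D.-1) => u v; field; rewrite gx gp.
Qed.

Lemma coef_mean_lower B e : (2 * r <= n)%N -> e \in edges B -> count_const * mu0 <= coef_mean B e.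
Proof.
move=> rn eB; rewrite coef_meanE // coef_scaleE mulrA ler_wpM2r ?exprn_ge0 ?(ltW p0) //.
exact: bin_lower.
Qed.

Lemma coef_mean_upper B e : e \in edges B -> coef_mean B e <= mu0.
Proof.
move=> eB; rewrite coef_meanE // coef_scaleE ler_wpM2r ?exprn_ge0 ?(ltW p0) //.
exact: bin_upper.
Qed.

End Counting.

(** * Moments of the clique count, of the coefficients and of the remainder *)

Section Moments.
Variables (R : realType) (n r : nat) (p Lam : R).
Let x : R := n%:R.
Hypotheses (p0 : 0 < p) (p1 : p <= 1) (L1 : 1 <= Lam)
  (HL : Lam ^+ 2 <= x ^+ 2 * p ^+ r.+1) (n0 : (0 < n)%N) (r1 : (1 < r)%N).
Local Notation V := 'I_n.
Implicit Types A B S : {set V}.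
Let x0 : 0 < x. Proof. by rewrite ltr0n. Qed.
Let p01 : 0 <= p <= 1. Proof. by rewrite ltW. Qed.
Local Notation D := 'C(r, 2).
Local Notation sig0 := (sd_scale n r p).
Local Notation mu0 := (coef_scale n r p).
Local Notation cN := (count_const R r).
Local Notation mu := (coef_mean r p).

Definition moment_const L : R := ((D%:R + 2) * (2 ^+ L.+1) ^+ D) ^+ L * expR (2 ^+ L * 4).

Lemma moment_const_gt0 L : 0 < moment_const L.
Proof. by rewrite mulr_gt0 ?expR_gt0 // exprn_gt0 // mulr_gt0 // ?exprn_gt0 // ltr_wpDl. Qed.

Lemma moment_w B (R0 : {set V}) L (calA : pred {set V}) (h : {set V} -> {set {set V}} -> R)
   (P : {set V} -> {set V} -> bool) (kap : R) :
  (#|R0| <= 2)%N ->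
  (forall A, calA A -> #|A| = r) -> 0 <= kap ->
  (forall A G, calA A -> `|h A G| <= (D%:R + 2) * \prod_(e in edges A :\: edges R0) ((e \in G)%:R + p)) ->
  (forall f : {ffun 'I_L -> {set V}}, (forall i, calA (f i)) ->
     E p (fun G => \prod_i h (f i) G) != 0 ->
     forall i, P (f i) (f i :&: others R0 f i)) ->
  (forall A S1 S2, calA A -> R0 \subset S1 -> R0 \subset S2 -> P A (A :&: (S1 :|: S2)) ->
     cost p (block_weight R B) A S1 * cost p (block_weight R B) A S2 <= kap ^+ 2) ->
  E p (fun G => (\sum_(A | calA A) h A G) ^+ L) <= moment_const L * kap ^+ L.
Proof.
move=> R02 cA k0 hb van kP.
have C_ge1 : 1 <= D%:R + 2 :> R by have := ler0n R D; lra.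
apply: le_trans (moment_bound p01 (block_weight_gt0 R n0 B) cA C_ge1 k0 hb van kP) _.
rewrite exprMn /moment_const mulrAC ler_wpM2r ?exprn_ge0 // ler_wpM2l ?exprn_ge0 //.
  by rewrite mulr_ge0 // ?exprn_ge0 // (le_trans _ C_ge1).
rewrite ler_expR ler_wpM2l ?exprn_ge0 // (_ : 4 = 2 + 2); last by ring.
by apply: lerD; [exact: (sum_block_weight R n0)|rewrite ler_nat].
Qed.

Definition mean : R := \sum_(A : {set V} | #|A| == r) p ^+ #|edges A|.

Lemma centred_sum_edges G :
  \sum_(A : {set V} | #|A| == r) mono R (edges A) G - mean =
  \sum_(A : {set V} | #|A| == r) centred p (@edges _) (fun=> 1) A G.
Proof. by rewrite -sumrB; apply: eq_bigr => A _; rewrite /centred mul1r. Qed.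

Lemma var_upper :
  E p (fun G => (\sum_(A : {set V} | #|A| == r) mono R (edges A) G - mean) ^+ 2) <=
  moment_const 2 * sig0 ^+ 2.
Proof.
rewrite /E (eq_condE _ _ (g := fun G => (\sum_(A : {set V} | #|A| == r)
   centred p (@edges _) (fun=> 1) A G) ^+ 2 : R^o)); last first.
  by move=> G; rewrite centred_sum_edges.
apply: (@moment_w set0 set0 2 (fun A => #|A| == r) _
   (fun _ N => (2 <= #|N|)%N)); rewrite ?cards0 //.
- by move=> A /eqP.
- exact/ltW/sd_scale_gt0.
- move=> A G /eqP rA; rewrite (_ : edges set0 = set0) ?setD0; last first.
    by apply/eqP; rewrite -cards_eq0 card_edges cards0.
  apply: le_trans (centred_bound (D := edges A) p01 _ _ _ _) _ => //.
    by rewrite setDv cards0 expr0.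
  rewrite ler_wpM2r ?lerDr //; apply: prodr_ge0 => e _; rewrite addr_ge0 // ltW //.
- move=> f fA ne i; rewrite leqNgt; apply: contra ne => h; apply/eqP.
  apply: (@E_centred_tuple0 _ _ _ _ _ _ _ i) => // j ji.
  rewrite -setI_eq0 -subset0; apply: subset_trans (edges_disj _ set0 ji) _.
  by rewrite subset0 -cards_eq0 card_edges bin_small.
- move=> A S1 S2 /eqP rA _ _ h; exact: (cost_var p0 p1 L1 HL).
Qed.

Lemma edges2 (e : {set V}) : #|e| = 2%N -> edges e = [set e].
Proof.
move=> e2; apply/setP => e'; rewrite !inE; apply/andP/eqP => [[/eqP c2 s]|->].
  by apply/eqP; rewrite eqEcard s c2 e2.
by rewrite e2.
Qed.

(** Every clique of the tuple contains [e], which is known from the start. If a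
    clique meets the others in [e] alone, then its edges outside the block
    belong to no other clique, since [e] itself lies inside the block. *)
Lemma coef_moment B e L : e \in edges B ->
  E p (fun G => (coef p B r e G - mu B e) ^+ L) <= moment_const L * (mu0 / Num.sqrt Lam) ^+ L.
Proof.
move=> eB; have e2 : #|e| = 2%N by move: eB; rewrite inE => /andP[/eqP].
have sL : 0 < Num.sqrt Lam by rewrite sqrtr_gt0 (lt_le_trans _ L1).
rewrite /E (eq_condE _ _ (g := fun G => (\sum_(A : {set V} | (#|A| == r) && (e \in edges A))
   centred p (outer B) (fun A => p ^+ #|inner B A|.-1) A G) ^+ L : R^o)); last first.
  move=> G; rewrite /coef /coef_mean -sumrB; congr (_ ^+ _); apply: eq_bigr => A _.
  by rewrite /centred mulrBr.
apply: (@moment_w set0 e L (fun A => (#|A| == r) && (e \in edges A)) _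
   (fun _ N => (3 <= #|N|)%N)); rewrite ?e2 //.
- by move=> A /andP[/eqP].
- by rewrite divr_ge0 ?ltW ?coef_scale_gt0.
- move=> A G /andP[/eqP rA eA]; rewrite (edges2 e2).
  have oD : outer B A \subset edges A :\: [set e].
    apply/subsetP => e'; rewrite /outer !in_setD => /andP[n' ->]; rewrite andbT inE.
    by apply: contra n' => /eqP ->.
  apply: le_trans (centred_bound (D := edges A :\: [set e]) p01 _ _ _ _) _ => //.
  + by rewrite exprn_ge0 // ltW.
  + rewrite (_ : _ :\: outer B A = inner B A :\: [set e]); last first.
      rewrite innerE; apply/setP => e'; rewrite /outer !(in_setD, in_setI, in_set1).
      by case: (e' == e); case: (e' \in edges A); case: (e' \in edges B).
    have : e \in inner B A by rewrite innerE inE eA eB.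
    rewrite -sub1set => s; rewrite cardsD (setIidPr s) cards1 subn1 //.
  + rewrite ler_wpM2r ?lerDr //; apply: prodr_ge0 => e' _; rewrite addr_ge0 // ltW //.
- move=> f fA ne i; rewrite leqNgt; apply: contra ne => h; apply/eqP.
  apply: (@E_centred_tuple0 _ _ _ _ _ _ _ i) => [A|j ji]; first exact: subsetDl.
  have /andP[_ efi] := fA i.
  have fe : f i :&: others e f i = e.
    apply/esym/eqP; rewrite eqEcard e2 -ltnS h andbT subsetI subsetUl andbT.
    by move: efi; rewrite inE => /andP[].
  rewrite -setI_eq0; apply/eqP/setP => e'; rewrite in_set0; apply/negbTE/negP.
  rewrite in_setI !in_setD => /andP[/andP[nB ej] /andP[_ ei]].
  have := subsetP (edges_disj f e ji) e'; rewrite in_setI ej ei fe (edges2 e2) => /(_ isT).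
  by rewrite inE => /eqP ee; rewrite ee eB in nB.
- move=> A S1 S2 /andP[/eqP rA eA] s1 s2 h; apply: (cost_coef p0 p1 L1 HL n0 r1 rA e2) => //.
  by move: eA; rewrite inE => /andP[].
Qed.

Lemma quad_moment B L (t th : R) : 0 < t -> 0 <= th -> beta R B <= 1 ->
  t ^+ 2 * beta R B ^+ 3 <= th ^+ 2 * Lam -> t ^+ 2 <= th ^+ 2 * (x * Lam) ->
  E p (fun G => (\sum_(A : {set V} | #|A| == r) quad p B A G) ^+ L) <=
  moment_const L * (sig0 * th / t) ^+ L.
Proof.
move=> t0 th0 b1 H1 H2.
apply: (@moment_w B set0 L (fun A => #|A| == r) _
   (fun _ N => (3 <= #|N :&: B|)%N)); rewrite ?cards0 //.
- by move=> A /eqP.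
- by rewrite divr_ge0 ?(ltW t0) // mulr_ge0 // ltW // sd_scale_gt0.
- move=> A G /eqP rA; rewrite (_ : edges set0 = set0) ?setD0; last first.
    by apply/eqP; rewrite -cards_eq0 card_edges cards0.
  by apply: le_trans (quad_bound p01 B A G) _; rewrite card_edges rA.
- move=> f fA ne i; rewrite leqNgt; apply: contra ne => h; apply/eqP.
  exact: (@E_quad_tuple0 _ _ _ B _ _ i).
- move=> A S1 S2 /eqP rA _ _ h; exact: (cost_quad p0 p1 L1 HL).
Qed.

Lemma E_centred2 A A' : #|A| = r -> #|A'| = r ->
  E p (fun G => centred p (@edges _) (fun=> 1) A G * centred p (@edges _) (fun=> 1) A' G) =
  p ^+ #|edges A :|: edges A'| - p ^+ D * p ^+ D.
Proof.
move=> rA rA'; rewrite /E (eq_condE _ _ (g := fun G =>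
  (mono R (edges A :|: edges A') G - p ^+ D * mono R (edges A) G) -
  (p ^+ D * mono R (edges A') G - p ^+ D * p ^+ D) : R^o)); last first.
  by move=> G; rewrite /centred monoU !card_edges rA rA'; ring.
have Em (A1 : {set {set V}}) : condE p (edges [set: V]) (mono R A1 : _ -> R^o) set0 = p ^+ #|A1 :&: edges [set: V]| * mono R (A1 :\: edges [set: V]) set0.
  exact: condE_mono.
have sub A1 : edges A1 \subset edges [set: V] by exact: edges_sub_all.
have sub2 : edges A :|: edges A' \subset edges [set: V] by rewrite subUset !sub.
have m0 (S : {set {set V}}) : S \subset edges [set: V] -> condE p (edges [set: V]) (mono R S : _ -> R^o) set0 = p ^+ #|S|.
  move=> s; rewrite Em (setIidPl s) (_ : S :\: _ = set0) ?/mono ?big_set0 ?mulr1 //.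
  by apply/eqP; rewrite setD_eq0.
have mc (S : {set {set V}}) : condE p (edges [set: V]) (fun G => p ^+ D * mono R S G : R^o) set0 =
    p ^+ D * condE p (edges [set: V]) (mono R S : _ -> R^o) set0.
  exact: (@condE_mulr _ _ _ _ (fun=> p ^+ D)).
rewrite condE_sub condE_sub condE_sub condE_const mc mc (m0 _ sub2) (m0 _ (sub A)) (m0 _ (sub A')).
rewrite card_edges card_edges rA rA'.
by move: (p ^+ D) (p ^+ #|_|) => u v; ring.
Qed.

Definition var_const : R := (8 * D%:R)^-1 * cN ^+ 2.

(** All covariances are nonnegative, and a pair of cliques sharing [c >= 1]
    edges has covariance at least [p^(2 D - 1) / 2], because [p <= 1/2]. As
    [c <= D], this is at least [c] times [p^(2 D - 1) / (2 D)]; bounding it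
    linearly in [c] makes the sum over pairs of cliques a sum over edges of
    squared numbers of cliques through the edge. *)
Lemma var_lower : p <= 1 / 2 -> (2 * r <= n)%N ->
  var_const * sig0 ^+ 2 <= E p (fun G => (\sum_(A : {set V} | #|A| == r) mono R (edges A) G - mean) ^+ 2).
Proof.
move=> p2 rn.
have D0 : 0 < D%:R :> R by rewrite ltr0n D_gt0.
rewrite /E (eq_condE _ _ (g := fun G => \sum_(A : {set V} | #|A| == r) \sum_(A' : {set V} | #|A'| == r)
  (centred p (@edges _) (fun=> 1) A G * centred p (@edges _) (fun=> 1) A' G) : R^o)); last first.
  move=> G; rewrite centred_sum_edges expr2 mulr_suml; apply: eq_bigr => A _.
  by rewrite mulr_sumr.
rewrite condE_sum.
under eq_bigr => A _ do rewrite condE_sum.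
apply: le_trans (_ : \sum_(A : {set V} | #|A| == r) \sum_(A' : {set V} | #|A'| == r)
   p ^+ (2 * D).-1 / (2 * D%:R) * #|edges A :&: edges A'|%:R <= _); last first.
  apply: ler_sum => A /eqP rA; apply: ler_sum => A' /eqP rA'.
  have := E_centred2 rA rA'; rewrite /E => ->.
  set c := #|_ :&: _|.
  have cU : #|edges A :|: edges A'| = (2 * D - c)%N.
    by rewrite cardsU !card_edges rA rA' mul2n addnn.
  have cD : (c <= D)%N by rewrite -rA -card_edges subset_leq_card ?subsetIl.
  rewrite cU -exprD addnn -mul2n.
  case: (posnP c) => [->|c0]; first by rewrite mulr0 subn0 subrr.
  have h1 : p ^+ (2 * D).-1 <= p ^+ (2 * D - c).
    by apply: ler_wiXn2l => //; [exact: ltW|lia].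
  have h2 : p ^+ (2 * D) = p * p ^+ (2 * D).-1.
    by rewrite -exprS prednK // muln_gt0 D_gt0.
  have q0 : 0 < p ^+ (2 * D).-1 by rewrite exprn_gt0.
  apply: le_trans (_ : p ^+ (2 * D).-1 / 2 <= _).
    rewrite invfM mulrA -mulrA ger_pMr; last by rewrite divr_gt0.
    by rewrite mulrC ler_pdivrMr // mul1r ler_nat.
  rewrite h2; move: (p ^+ (2 * D).-1) (p ^+ (2 * D - c)) h1 q0 => u v uv u0.
  have h3 : p * u <= 1 / 2 * u by rewrite ler_pM2r.
  by apply: le_trans (lerB uv h3); rewrite half_sub.
under eq_bigr => A _ do rewrite -mulr_sumr.
rewrite -mulr_sumr.
have -> : \sum_(A : {set V} | #|A| == r) \sum_(A' : {set V} | #|A'| == r) #|edges A :&: edges A'|%:R =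
   \sum_(e in edges [set: V]) ('C(n - 2, r - 2)%:R ^+ 2 : R).
  transitivity (\sum_(A : {set V} | #|A| == r) \sum_(A' : {set V} | #|A'| == r)
     \sum_(e in edges [set: V]) (e \in edges A)%:R * (e \in edges A')%:R : R).
    apply: eq_bigr => A _; apply: eq_bigr => A' _.
    rewrite -sum1_card natr_sum big_mkcond [RHS]big_mkcond; apply: eq_bigr => e _ /=.
    rewrite in_setI; case: (boolP (e \in edges A)) => [eA|_]; last by rewrite mul0r if_same.
    by rewrite (subsetP (edges_sub_all A) _ eA) mul1r; case: (e \in edges A').
  under eq_bigr => A _ do rewrite exchange_big.
  rewrite exchange_big; apply: eq_bigr => e eT /=.
  have e2 : #|e| = 2%N by move: eT; rewrite inE => /andP[/eqP].
  under eq_bigr => A _ do rewrite -mulr_sumr.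
  rewrite -mulr_suml expr2.
  suff -> : \sum_(A : {set V} | #|A| == r) (e \in edges A)%:R = 'C(n - 2, r - 2)%:R :> R by [].
  have := @card_supersets _ e r; rewrite e2 card_ord => <- //.
  rewrite -[in RHS]sum1_card natr_sum [RHS]big_mkcond [LHS]big_mkcond; apply: eq_bigr => A _.
  by rewrite [in RHS]inE [e \in _]inE e2 /=; case: (#|A| == r); case: (e \subset A).
rewrite sumr_const card_edges cardsT card_ord.
rewrite sd_scale_sq // -/x.
have b2 : x ^+ 2 / 4 <= 'C(n, 2)%:R.
  rewrite ler_pdivrMr // -natrX -natrM ler_nat.
  have := bin2_double n; have : (2 <= n)%N by lia.
  by nia.
have mE : clique_mass n r p ^+ 2 / (x ^+ 2 * p) = p ^+ (2 * D).-1 * x ^+ 2 * (x ^+ (r - 2)) ^+ 2.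
  have gx : x != 0 by rewrite gt_eqF.
  have gp : p != 0 by rewrite gt_eqF.
  rewrite /clique_mass -/x.
  have -> : x ^+ r = x ^+ 2 * x ^+ (r - 2) by rewrite -exprD subnKC.
  have -> : (x ^+ 2 * x ^+ (r - 2) * p ^+ D) ^+ 2 = (x ^+ 2 * x ^+ (r - 2)) ^+ 2 * (p * p ^+ (2 * D).-1).
    by rewrite exprMn -exprM -exprS prednK ?muln_gt0 ?D_gt0 // mulnC.
  by field; rewrite gx gp.
rewrite mE /var_const.
have bl := @bin_lower R _ _ n0 r1 rn.
have bl2 : (cN * x ^+ (r - 2)) ^+ 2 <= 'C(n - 2, r - 2)%:R ^+ 2.
  by rewrite lerXn2r ?nnegrE // mulr_ge0 ?exprn_ge0 // ltW // count_const_gt0.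
have q0 : 0 < p ^+ (2 * D).-1 by rewrite exprn_gt0.
have -> : (8 * D%:R)^-1 * cN ^+ 2 * (p ^+ (2 * D).-1 * x ^+ 2 * (x ^+ (r - 2)) ^+ 2) =
  p ^+ (2 * D).-1 / (2 * D%:R) * ((x ^+ 2 / 4) * (cN * x ^+ (r - 2)) ^+ 2).
  by rewrite exprMn; field; rewrite gt_eqF.
rewrite ler_wpM2l ?divr_ge0 ?(ltW q0) ?mulr_ge0 ?(ltW D0) //.
rewrite -[X in _ <= X]mulr_natl; apply: ler_pM => //.
- by rewrite divr_ge0 // exprn_ge0 // ltW.
- by rewrite exprn_ge0 // mulr_ge0 ?exprn_ge0 // ltW // count_const_gt0.
Qed.

End Moments.

(** * Decay given the edges outside the block *)

Section Conditioning.
Variables (R : realType) (V : finType) (p : R) (B : {set V}) (r : nat).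
Hypotheses (p0 : 0 < p) (p2 : p <= 1 / 2).
Implicit Types (A : {set V}) (S D G H : {set {set V}}).
Let p01 : 0 <= p <= 1. Proof. by rewrite ltW //= (le_trans p2) // ler_pdivrMr // mul1r ler1n. Qed.
Local Notation M := (edges B).
Local Notation Dr := 'C(r, 2).

Lemma cnorm_condE_le D (F : {set {set V}} -> Rcomplex R) G (c : R) :
  (forall H, H \subset D -> cnorm (F ((G :\: D) :|: H)) <= c) -> cnorm (condE p D F G) <= c.
Proof.
move=> Fc; rewrite /condE; apply: le_trans (cnorm_sum _ _) _.
rewrite -[leRHS]mul1r -(sum_weight p D) mulr_suml; apply: ler_sum => H.
rewrite powersetE => HD; rewrite cnormZ (ger0_norm (weight_ge0 p01 _ _)).
by apply: ler_wpM2l (Fc _ HD); apply: weight_ge0.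
Qed.

Definition quad_const : R := (Dr%:R + 2) * 2 ^+ Dr.

Lemma quad_const_ge0 : 0 <= quad_const.
Proof. by rewrite mulr_ge0 ?exprn_ge0 // addr_ge0. Qed.

Lemma quad_le_const A G : #|A| = r -> `|quad p B A G| <= quad_const.
Proof.
move=> rA; apply: le_trans (quad_bound p01 _ _ _) _; rewrite card_edges rA.
apply: ler_wpM2l; first by rewrite addr_ge0.
rewrite -rA -card_edges -prodr_const; apply: ler_prod => e _.
case/andP: p01 => p0' p1'; rewrite addr_ge0 //= (_ : 2 = 1 + 1) //.
by apply: lerD => //; case: (e \in G).
Qed.

Variables (s low : R).
Hypotheses (s0 : 0 < s) (low0 : 0 < low).

(** The coefficients are large enough for every edge of the block to contribute
    to the decay, and small enough for [cnorm_bernoulli] to apply. *)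
Definition good G := forall e, e \in M -> low <= coef p B r e G /\ s * coef p B r e G <= 1.

(** The factor of exp(i s X) that comes from the linear part. *)
Definition phase G : Rcomplex R :=
  expi (s * base p B r G) * \prod_(e in M) expi (s * (coef p B r e G * (e \in G)%:R)).

Definition rate : R := p * (s * low) ^+ 2 / 8.

Lemma rate_ge0 : 0 <= rate.
Proof. by rewrite divr_ge0 // mulr_ge0 ?exprn_even_ge0 // ltW. Qed.

Lemma edge_decay e G : e \in M -> good G ->
  cnorm (p *: expi (s * (coef p B r e G * 1)) + (1 - p) *: (expi (s * (coef p B r e G * 0)))) <= expR (- rate).
Proof.
move=> eM /(_ e eM)[h1 h2]; rewrite mulr1 mulr0 mulr0.
have c0 : 0 <= s * coef p B r e G by rewrite mulr_ge0 ?(ltW s0) // (le_trans (ltW low0)).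
apply: le_trans (cnorm_bernoulli (ltW p0) p2 _) _; first by rewrite ger0_norm.
rewrite ler_expR lerN2 /rate ler_wpM2r ?invr_ge0 ?ler0n // ler_wpM2l ?(ltW p0) //.
rewrite lerXn2r ?nnegrE ?(mulr_ge0 (ltW s0) (ltW low0)) //.
by rewrite ler_pM2l.
Qed.

Lemma coef_out G S H e : S \subset M -> H \subset S ->
  coef p B r e ((G :\: S) :|: H) = coef p B r e G.
Proof.
move=> SM HS; apply: coef_free; rewrite setDUl setDDl (setUidPr SM).
by rewrite (eqP (_ : H :\: M == set0)) ?setU0 // setD_eq0 (subset_trans HS).
Qed.

Lemma good_out G S H : S \subset M -> H \subset S -> good G -> good ((G :\: S) :|: H).
Proof. by move=> SM HS gG e eM; rewrite coef_out //; exact: gG. Qed.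

(** A product of [j] remainders involves at most [j * C(r,2)] edges of the block.
    Once these are fixed, all other block edges are independent, and each of
    them contributes its one-edge factor. *)
Lemma phase_decay j (f : {ffun 'I_j -> {set V}}) G : (forall i, #|f i| = r) -> good G ->
  (j * Dr <= #|M|)%N ->
  cnorm (condE p M (fun H => (\prod_i quad p B (f i) H) *: phase H) G) <=
  quad_const ^+ j * expR (- rate * (#|M| - j * Dr)%:R).
Proof.
move=> rf gG jM.
pose S := M :&: \bigcup_i edges (f i).
have SM : S \subset M by exact: subsetIl.
have cS : (#|S| <= j * Dr)%N.
  apply: leq_trans (subset_leq_card (subsetIr _ _)) _.
  rewrite -[X in (_ <= X * _)%N](card_ord j) -sum_nat_const.
  elim/big_rec2: _ => [|i y z _ IH]; first by rewrite cards0.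
  apply: leq_trans (leq_card_setU _ _) _; apply: leq_add IH.
  by rewrite card_edges rf.
have MS : M = S :|: (M :\: S) by rewrite -{1}(setIidPr SM) setID.
have disjD : [disjoint S & M :\: S].
  by rewrite -setI_eq0 setDE setICA setICr setI0.
rewrite [X in condE p X]MS condE_condE; last by exact: disjD.
apply: cnorm_condE_le => H HS; set G1 := (G :\: S) :|: H.
have gG1 : good G1 by exact: good_out.
(* With the edges of [S] fixed, [a] is a constant and only the one-edge factors
   collected in [b] remain random. *)
pose a H : Rcomplex R := (\prod_i quad p B (f i) H) *:
  (expi (s * base p B r H) * \prod_(e in S) expi (s * (coef p B r e H * (e \in H)%:R))).
pose b H : Rcomplex R := \prod_(e in M :\: S) expi (s * (coef p B r e H * (e \in H)%:R)).
have -> : condE p (M :\: S) (fun H => (\prod_i quad p B (f i) H) *: phase H) G1 =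
   condE p (M :\: S) (fun H => a H * b H) G1.
  apply: eq_condE => H'; rewrite /a /b /phase -scalerAl -mulrA; congr (_ *: (_ * _)).
  rewrite (eq_bigl [predU S & M :\: S]) ?bigU //.
  by move=> e; rewrite {1}MS !inE.
rewrite condE_mulc; last first.
  move=> K K' KK; rewrite /a; congr (_ *: (_ * _)).
  - apply: eq_bigr => i _; apply: quad_free_of KK; rewrite -setI_eq0.
    apply/eqP/setP => e; rewrite in_set0; apply/negbTE/negP.
    rewrite !in_setI in_setD in_setI => /andP[ei /andP[/negP eS eM]]; apply: eS.
    by rewrite eM /=; apply/bigcupP; exists i.
  - congr expi; congr (_ * _); apply: base_free.
    by move/(congr1 (fun Z => Z :\: M)): KK; rewrite !setDDl (setUidPr (subsetDl _ _)).
  - apply: eq_bigr => e eS; congr (expi (s * (_ * _))).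
      apply: coef_free.
      by move/(congr1 (fun Z => Z :\: M)): KK; rewrite !setDDl (setUidPr (subsetDl _ _)).
    apply: (ind_free_of _ _ KK); by rewrite in_setD eS.
rewrite cnormM; apply: ler_pM; rewrite ?cnorm_ge0 //.
  rewrite /a cnormZ cnormM cnorm_expi mul1r cnorm_prod [X in _ * X]big1 ?mulr1 => [|e _]; last exact: cnorm_expi.
  rewrite normr_prod -[X in _ ^+ X](card_ord j) -prodr_const.
  by apply: ler_prod => i _; rewrite normr_ge0 quad_le_const.
pose g e (x : bool) : Rcomplex R := expi (s * (coef p B r e G1 * x%:R)).
have -> : condE p (M :\: S) b G1 = condE p (M :\: S) (fun H => \prod_(e in M :\: S) g e (e \in H)) G1.
  apply: eq_bigr => H'; rewrite powersetE => H'S; congr (_ *: _).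
  apply: eq_bigr => e _; rewrite /g coef_out //; exact: subsetDl.
rewrite condE_prodc cnorm_prod.
apply: le_trans (_ : \prod_(e in M :\: S) expR (- rate) <= _).
  apply: ler_prod => e; rewrite in_setD => /andP[_ eM]; rewrite cnorm_ge0 /=.
  exact: edge_decay.
rewrite prodr_const -expRM_natr ler_expR ler_wnM2l ?oppr_le0 ?rate_ge0 //.
rewrite ler_nat cardsD (setIidPr SM); exact: leq_sub2l.
Qed.

Definition num_cliques := #|[set A : {set V} | #|A| == r]|.

(** The crude factor, a power of the number of all cliques, is polynomial in n
    and will be absorbed by the exponential. *)
Lemma phase_power_decay j G : good G -> (j * Dr <= #|M|)%N ->
  cnorm (condE p M (fun H => (\sum_(A : {set V} | #|A| == r) quad p B A H) ^+ j *: phase H) G) <=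
  (num_cliques%:R * quad_const) ^+ j * expR (- rate * (#|M| - j * Dr)%:R).
Proof.
move=> gG jM.
have -> : (num_cliques%:R * quad_const) ^+ j = \sum_(f : {ffun 'I_j -> {set V}}) \prod_i (if #|f i| == r then quad_const else 0).
  rewrite -(bigA_distr_bigA (fun _ (A : {set V}) => if #|A| == r then quad_const else 0)).
  rewrite prodr_const card_ord -big_mkcond /= sumr_const -[in RHS]mulr_natl.
  congr ((_ %:R * _) ^+ _); rewrite /num_cliques; apply: eq_card => A; by rewrite inE.
rewrite (eq_condE _ _ (g := fun H => \sum_(f : {ffun 'I_j -> {set V}})
   (\prod_i (if #|f i| == r then quad p B (f i) H else 0)) *: phase H)); last first.
  move=> H; rewrite -scaler_suml; congr (_ *: _).
  rewrite big_mkcond -[in X in _ ^+ X](card_ord j) -prodr_const /=.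
  by rewrite bigA_distr_bigA.
rewrite condE_sum mulr_suml; apply: le_trans (cnorm_sum _ _) _; apply: ler_sum => f _.
case: (boolP [forall i, #|f i| == r]) => [/forallP fr|/forallPn[i /negbTE fi]]; last first.
  rewrite (eq_condE _ _ (g := fun=> 0)) ?condE_const; last first.
    by move=> H; rewrite (bigD1 i) //= fi mul0r scale0r.
  by rewrite (bigD1 i) //= fi mul0r mul0r /cnorm normr0.
rewrite (eq_condE _ _ (g := fun H => (\prod_i quad p B (f i) H) *: phase H)); last first.
  by move=> H; congr (_ *: _); apply: eq_bigr => i _; rewrite fr.
rewrite (eq_bigr (fun=> quad_const)) => [|i _]; last by rewrite fr.
rewrite prodr_const card_ord.
by apply: phase_decay => // i; apply/eqP.
Qed.

Local Notation X G := (\sum_(A : {set V} | #|A| == r) mono R (edges A) G).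
Local Notation Q G := (\sum_(A : {set V} | #|A| == r) quad p B A G).

Lemma expi_split G : expi (s * X G) = phase G * expi (s * Q G).
Proof.
have -> : X G = base p B r G + \sum_(e in M) coef p B r e G * (e \in G)%:R + Q G.
  rewrite -sum_linE -big_split; apply: eq_bigr => A _ /=.
  by rewrite /quad addrC subrK.
rewrite mulrDr expiD mulrDr expiD mulr_sumr expi_sum //.
Qed.

Lemma cnorm_phase G : cnorm (phase G) = 1.
Proof.
rewrite /phase cnormM cnorm_expi mul1r cnorm_prod big1 // => e _.
exact: cnorm_expi.
Qed.

(** Taylor expansion of the factor exp(i s Q) only. An even order makes the
    error term a moment, without absolute values. *)
Lemma conditional_bound L G : ~~ odd L -> good G -> (L * Dr <= #|M|)%N ->
  cnorm (condE p M (fun H => expi (s * X H)) G) <=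
  \sum_(j < L) 2 * (s * (num_cliques%:R * quad_const)) ^+ j * expR (- rate * (#|M| - L * Dr)%:R)
  + 2 * condE p M (fun H => (s * Q H) ^+ L : R^o) G.
Proof.
move=> oL gG LM.
have [c [c2 Hc]] := taylor_expi R L.
have -> : condE p M (fun H => expi (s * X H)) G =
  \sum_(j < L) c j * (s ^+ j *: condE p M (fun H => Q H ^+ j *: phase H) G) +
  condE p M (fun H => phase H * (expi (s * Q H) - \sum_(j < L) (s * Q H) ^+ j *: c j)) G.
  have -> : \sum_(j < L) c j * (s ^+ j *: condE p M (fun H => Q H ^+ j *: phase H) G) =
    condE p M (fun H => \sum_(j < L) phase H * ((s * Q H) ^+ j *: c j)) G.
    rewrite condE_sum; apply: eq_bigr => j _.
    rewrite -condE_scale -(@condE_mulc _ _ _ _ (fun=> c j)) //; apply: eq_condE => H.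
    by rewrite scalerA -exprMn mulrC -scalerAl [in RHS]mulrC -scalerAl [c j * _]mulrC.
  rewrite -condE_add; apply: eq_condE => H; rewrite -mulr_sumr -mulrDr.
  by rewrite addrC subrK expi_split.
apply: le_trans (cnormD _ _) _; apply: lerD.
  apply: le_trans (cnorm_sum _ _) _; apply: ler_sum => j _.
  have jL : (j * Dr <= L * Dr)%N by rewrite leq_mul2r (ltnW (ltn_ord j)) orbT.
  rewrite cnormM cnormZ -mulrA; apply: ler_pM; rewrite ?cnorm_ge0 ?mulr_ge0 ?cnorm_ge0 //.
  rewrite ger0_norm ?exprn_ge0 ?(ltW s0) // exprMn -mulrA.
  apply: ler_wpM2l; first by rewrite exprn_ge0 // ltW.
  apply: le_trans (phase_power_decay gG (leq_trans jL LM)) _.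
  apply: ler_wpM2l; first by rewrite exprn_ge0 // mulr_ge0 // quad_const_ge0.
  rewrite ler_expR ler_wnM2l ?oppr_le0 ?rate_ge0 // ler_nat; exact: leq_sub2l.
apply: le_trans (cnorm_condE p01 _ _ _) _.
rewrite -(@condE_mulr _ _ _ _ (fun=> 2)) //; apply: le_condE => // H.
rewrite cnormM cnorm_phase mul1r; apply: le_trans (Hc _) _.
by rewrite -normrX ger0_norm // exprn_even_ge0.
Qed.

End Conditioning.

(** * Averaging over the edges outside the block *)

Section Unconditional.
Variables (R : realType) (n r : nat) (p Lam : R).
Let x : R := n%:R.
Hypotheses (p0 : 0 < p) (p2 : p <= 1 / 2) (L1 : 1 <= Lam)
  (HL : Lam ^+ 2 <= x ^+ 2 * p ^+ r.+1) (n0 : (0 < n)%N) (r1 : (1 < r)%N)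
  (rn : (2 * r <= n)%N).
Local Notation V := 'I_n.
Let p1 : p <= 1. Proof. by rewrite (le_trans p2) // ler_pdivrMr // mul1r ler1n. Qed.
Let p01 : 0 <= p <= 1. Proof. by rewrite ltW. Qed.
Local Notation T := (edges [set: V]).
Local Notation sig0 := (sd_scale n r p).
Local Notation mu0 := (coef_scale n r p).
Local Notation cN := (count_const R r).
Local Notation X G := (\sum_(A : {set V} | #|A| == r) mono R (edges A) G).

Variables (B : {set V}) (s t th : R) (L : nat).
Local Notation M := (edges B).
Local Notation Q G := (\sum_(A : {set V} | #|A| == r) quad p B A G).
Hypotheses (s0 : 0 < s) (t0 : 0 < t) (th0 : 0 <= th) (b1 : beta R B <= 1)
  (H1 : t ^+ 2 * beta R B ^+ 3 <= th ^+ 2 * Lam) (H2 : t ^+ 2 <= th ^+ 2 * (x * Lam))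
  (oL : ~~ odd L) (LM : (L * 'C(r, 2) <= #|M|)%N) (smu : s * (3 / 2 * mu0) <= 1).

Let low : R := cN * mu0 / 2.
Let low0 : 0 < low.
Proof. by rewrite divr_gt0 // mulr_gt0 ?count_const_gt0 // coef_scale_gt0. Qed.

Let coef_mean_gt0 e : e \in M -> 0 < coef_mean r p B e.
Proof.
move=> eM; apply: lt_le_trans (coef_mean_lower n0 r1 p0 rn eM).
by rewrite mulr_gt0 ?count_const_gt0 // coef_scale_gt0.
Qed.

(** Normalized so that a coefficient with [`|dev e G| <= 1] is between 1/2 and
    3/2 of its mean. *)
Definition dev e (G : {set {set V}}) : R := (coef p B r e G - coef_mean r p B e) / (coef_mean r p B e / 2).

Lemma dev_good G : (forall e, e \in M -> `|dev e G| <= 1) -> good p B r s low G.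
Proof.
move=> H e eM; have m0 := coef_mean_gt0 eM; have := H e eM.
have m2 : 0 < coef_mean r p B e / 2 by rewrite divr_gt0.
rewrite /dev normrM normfV (gtr0_norm m2) ler_pdivrMr // mul1r ler_norml => /andP[h1 h2].
have h3 := coef_mean_lower n0 r1 p0 rn eM.
have h4 := coef_mean_upper n0 r1 p0 eM.
split; first by rewrite /low; lra.
apply: le_trans smu; rewrite ler_pM2l //; lra.
Qed.

Definition expterm : R := \sum_(j < L) 2 * (s * ((num_cliques V r)%:R * quad_const R r)) ^+ j *
   expR (- rate p s low * (#|M| - L * 'C(r, 2))%:R).

Lemma expterm_ge0 : 0 <= expterm.
Proof.
apply: sumr_ge0 => j _; rewrite !mulr_ge0 ?expR_ge0 // exprn_ge0 // mulr_ge0 ?(ltW s0) //.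
by rewrite mulr_ge0 // quad_const_ge0.
Qed.

(** One random variable that works for every outcome outside the block: for a
    good outcome by [conditional_bound]; otherwise some [dev e] exceeds 1 in
    absolute value, and its even power already exceeds the trivial bound 1.
    This pointwise form of the Markov inequality avoids splitting the
    expectation according to events. *)
Definition dominant (G : {set {set V}}) : R :=
  (\sum_(e in M) dev e G ^+ L + expterm) + 2 * (s * Q G) ^+ L.

Lemma dev_free e : free_of M (dev e).
Proof. by move=> G G' h; rewrite /dev (@coef_free _ _ _ _ _ e _ _ h). Qed.

Lemma pointwise_bound G :
  cnorm (condE p M (fun H => expi (s * X H)) G) <= condE p M (dominant : _ -> R^o) G.
Proof.
have -> : condE p M (dominant : _ -> R^o) G =
   (\sum_(e in M) dev e G ^+ L + expterm) + 2 * condE p M (fun H => (s * Q H) ^+ L : R^o) G.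
  rewrite /dominant condE_add condE_mulr //; congr (_ + _).
  rewrite condE_id // => K K' h; congr (_ + _); apply: eq_bigr => e _.
  by rewrite (dev_free e h).
have d0 e : 0 <= dev e G ^+ L by rewrite exprn_even_ge0.
have q0 : 0 <= 2 * condE p M (fun H => (s * Q H) ^+ L : R^o) G.
  by rewrite mulr_ge0 // condE_ge0 // => H; rewrite exprn_even_ge0.
case: (boolP [forall e in M, `|dev e G| <= 1]) => [/forall_inP gG|].
  apply: le_trans (conditional_bound p0 p2 s0 low0 oL (dev_good gG) LM) _.
  by rewrite lerD2r lerDr sumr_ge0.
rewrite negb_forall_in => /exists_inP[e eM]; rewrite -ltNge => bad.
apply: le_trans (_ : 1 <= _).
  by apply: cnorm_condE_le => // H _; rewrite cnorm_expi.
apply: le_trans (_ : dev e G ^+ L <= _).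
  have -> : dev e G ^+ L = `|dev e G| ^+ L by rewrite -normrX ger0_norm.
  by rewrite exprn_ege1 // ltW.
rewrite (bigD1 e) //= -!addrA lerDl !addr_ge0 ?expterm_ge0 //.
by apply: sumr_ge0.
Qed.

Lemma E_dominant : E p dominant <=
  #|M|%:R * (moment_const R r L * (2 / (cN * Num.sqrt Lam)) ^+ L) + expterm
  + 2 * (moment_const R r L * (s * (sig0 * th / t)) ^+ L).
Proof.
rewrite /E /dominant condE_add condE_add condE_const condE_mulr // condE_sum.
have sL : 0 < Num.sqrt Lam by rewrite sqrtr_gt0 (lt_le_trans _ L1).
apply: lerD; first apply: lerD => //.
  rewrite mulr_natl -sumr_const; apply: ler_sum => e eM.
  have m0 := coef_mean_gt0 eM.
  have m2 : 0 < coef_mean r p B e / 2 by rewrite divr_gt0.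
  rewrite (eq_condE _ _ (g := fun G => (coef_mean r p B e / 2)^-1 ^+ L * (coef p B r e G - coef_mean r p B e) ^+ L : R^o)); last first.
    by move=> G; rewrite /dev exprMn mulrC.
  rewrite (@condE_mulr _ _ _ _ (fun=> (coef_mean r p B e / 2)^-1 ^+ L)) //.
  have cm := coef_moment p0 p1 L1 HL n0 r1 L eM.
  apply: le_trans (ler_wpM2l _ cm) _; first by rewrite exprn_ge0 // invr_ge0 ltW.
  rewrite mulrCA ler_wpM2l ?(ltW (moment_const_gt0 _ _ _)) // -exprMn.
  rewrite lerXn2r ?nnegrE //.
  - by rewrite mulr_ge0 ?invr_ge0 ?(ltW m2) // divr_ge0 ?(ltW sL) // ltW // coef_scale_gt0.
  - by rewrite divr_ge0 // mulr_ge0 ?(ltW sL) // ltW // count_const_gt0.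
  have h3 := coef_mean_lower n0 r1 p0 rn eM.
  have -> : 2 / (cN * Num.sqrt Lam) = 2 / cN / Num.sqrt Lam by rewrite invfM mulrA.
  rewrite mulrA; apply: ler_wpM2r; first by rewrite invr_ge0 ltW.
  rewrite mulrC ler_pdivrMr // mulrAC ler_pdivlMr ?count_const_gt0 //.
  by rewrite [mu0 * _]mulrC [2 * _]mulrC divfK ?pnatr_eq0.
apply: ler_wpM2l => //.
rewrite (eq_condE _ _ (g := fun G => s ^+ L * (Q G) ^+ L : R^o)); last first.
  by move=> G; rewrite exprMn.
rewrite (@condE_mulr _ _ _ _ (fun=> s ^+ L)) //.
have qm := quad_moment p0 p1 L1 HL n0 r1 L t0 th0 b1 H1 H2.
apply: le_trans (ler_wpM2l _ qm) _; first by rewrite exprn_ge0 // ltW.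
by rewrite mulrCA -exprMn.
Qed.

Lemma charfun_bound :
  cnorm (condE p T (fun G => expi (s * X G)) set0) <=
  #|M|%:R * (moment_const R r L * (2 / (cN * Num.sqrt Lam)) ^+ L) + expterm
  + 2 * (moment_const R r L * (s * (sig0 * th / t)) ^+ L).
Proof.
have MT : M \subset T by exact: edges_sub_all.
have TM : T = (T :\: M) :|: M by rewrite setUC -{1}(setIidPr MT) setID.
have dTM : [disjoint T :\: M & M] by rewrite -setI_eq0 setDE -setIA [_ :&: M]setIC setICr setI0.
apply: le_trans E_dominant; rewrite /E TM !condE_condE //.
apply: le_trans (cnorm_condE p01 _ _ _) _; apply: le_condE => // G.
exact: pointwise_bound.
Qed.

End Unconditional.

(** * The clique count and its variance as expectations over edges *)

Section StandardDeviation.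
Variables (R : realType) (n r : nat) (p : R).
Local Notation X G := (\sum_(A : {set 'I_n} | #|A| == r) mono R (edges A) G).

Lemma clique_meanE : clique_mean n r p = mean n r p.
Proof.
rewrite /clique_mean gnp_expectationE.
rewrite (eq_condE _ _ (g := fun G => X G : R^o)); last by move=> G; rewrite clique_countE.
rewrite condE_sum; apply: eq_bigr => A _; rewrite condE_mono.
rewrite (setIidPl (edges_sub_all A)) (_ : edges A :\: _ = set0) ?/mono ?big_set0 ?mulr1 //.
by apply/eqP; rewrite setD_eq0 edges_sub_all.
Qed.

Lemma clique_varianceE :
  clique_variance n r p = E p (fun G => (X G - mean n r p) ^+ 2).
Proof.
rewrite /clique_variance gnp_expectationE.
rewrite (eq_condE _ _ (g := fun G => (X G - mean n r p) ^+ 2 : R^o)) // => G.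
by rewrite clique_meanE clique_countE.
Qed.

Lemma clique_charfunE (t : R) :
  clique_charfun n r p t =
  condE p (edges [set: 'I_n]) (fun G => expi (t / clique_sd n r p * X G)) set0.
Proof.
rewrite /clique_charfun gnp_expectationE; apply: eq_condE => G.
by rewrite clique_countE mulrAC.
Qed.

End StandardDeviation.

(** * Real powers *)

Section Powers.
Variable R : realType.
Implicit Types x y a b : R.

Lemma powR_add x a b : 0 < x -> x `^ (a + b) = x `^ a * x `^ b.
Proof. by move=> x0; rewrite powRD // (gt_eqF x0) implybT. Qed.

Lemma powR_expn x a k : (x `^ a) ^+ k = x `^ (a * k%:R).
Proof. by rewrite -powR_mulrn ?powR_ge0 // -powRrM. Qed.

Lemma nat_above x : exists m : nat, x <= m%:R.
Proof.
exists (Num.bound `|x|); apply: le_trans (ler_norm x) _.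
exact/ltW/archi_boundP.
Qed.

Lemma powR_eventually e C : 0 < e -> 0 <= C ->
  exists N : nat, forall n : nat, (N <= n)%N -> C <= (n%:R : R) `^ e.
Proof.
move=> e0 C_ge0; have [N NC] := nat_above (C `^ e^-1).
exists N => n Nn; have h : C `^ e^-1 <= n%:R by apply: le_trans NC _; rewrite ler_nat.
have -> : C = (C `^ e^-1) `^ e by rewrite -powRrM mulVf ?gt_eqF // powRr1.
by apply: ge0_ler_powR; rewrite ?nnegrE ?powR_ge0 // ltW.
Qed.

Lemma expRN_poly (z : R) m : 0 < z -> expR (- z) <= m.+1`!%:R / z ^+ m.+1.
Proof.
move=> z0; have f0 : 0 < (m.+1`!)%:R :> R by rewrite ltr0n fact_gt0.
have zm : 0 < z ^+ m.+1 by rewrite exprn_gt0.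
have h : z ^+ m.+1 / (m.+1`!)%:R <= expR z.
  by apply: le_trans (expR_ge1Dxn m (ltW z0)); rewrite lerDr.
rewrite expRN ler_pdivlMr // mulrC ler_pdivrMr ?expR_gt0 // mulrC.
by rewrite -ler_pdivrMr.
Qed.

End Powers.

(** * Choice of the parameters *)

(** A block of [b] vertices keeps a number of order [b^2] of edges after the
    removal of a bounded number [u]. *)
Lemma bin2_room (u b : nat) : (2 + 8 * u <= b)%N ->
  (u <= 'C(b, 2))%N /\ (b * b <= 8 * ('C(b, 2) - u))%N.
Proof.
case: b => [|z] // h; have := bin2_double z.+1; move: 'C(_, _) => v /= h2.
have zz : (z <= z * z)%N by rewrite leq_pmull //; lia.
have h3 : (2 * v = z * z + z)%N by rewrite h2; lia.
split; first by lia.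
rewrite mulnBr; have -> : (z.+1 * z.+1 = z * z + 2 * z + 1)%N by lia.
move: (z * z)%N zz h3 => w zz h3; lia.
Qed.

Section Scales.
Variables (R : realType) (n r L m : nat) (c K d0 eps p t : R).
Let x : R := n%:R.
Local Notation Dr := 'C(r, 2).
Local Notation cN := (count_const R r).
Local Notation cV := (var_const R r).
Local Notation Kv := (moment_const R r 2).

(** The requirements on n are collected in two thresholds: [size_threshold]
    bounds n^(eps/2) from below, and the three error constants, which multiply
    n^(- K - 1) in the three terms of [charfun_bound], bound n itself. None of
    them depends on n, [p] or [t]. *)
Definition size_threshold : R := 2 + 8 * (L * Dr)%:R + 3 / 2 / Num.sqrt cV.
Definition coef_error : R := moment_const R r L * (2 / cN) ^+ L.
Definition decay_const : R := cN ^+ 2 / (256 * Kv).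
Definition decay_error : R := L%:R * (2 * (1 + quad_const R r / Num.sqrt cV) ^+ L) * ((m.+1`!)%:R / decay_const ^+ m.+1).
Definition quad_error : R := 2 * (moment_const R r L * (3 / Num.sqrt cV) ^+ L).

Hypotheses (n0 : (0 < n)%N) (r1 : (1 < r)%N) (rn : (2 * r <= n)%N)
  (K0 : 0 < K) (d00 : 0 < d0) (d01 : d0 <= 1) (e0 : 0 < eps) (ed : eps <= d0 / 8)
  (dc : d0 * 2 = 2 - c * r.+1%:R)
  (oL : ~~ odd L) (LK : K + 3 <= d0 / 4 * L%:R)
  (mK : r.+1%:R * L%:R + K + 1 <= eps * m.+1%:R)
  (xC0 : size_threshold <= x `^ (eps / 2)) (xC : coef_error + decay_error + quad_error <= x)
  (pc : x `^ (- c) <= p) (p2 : p <= 1 / 2)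
  (te : x `^ eps <= t) (tu : t <= x `^ (1 / 2 + eps) * p).

Let x0 : 0 < x. Proof. by rewrite ltr0n. Qed.
Let x1 : 1 <= x. Proof. by rewrite ler1n. Qed.
Let p0 : 0 < p. Proof. by apply: lt_le_trans pc; exact: powR_gt0. Qed.
Let p1 : p <= 1. Proof. by rewrite (le_trans p2) // ler_pdivrMr // mul1r ler1n. Qed.
Let t0 : 0 < t. Proof. by apply: lt_le_trans te; exact: powR_gt0. Qed.
Let pw a b : a <= b -> x `^ a <= x `^ b. Proof. exact: ler_powR. Qed.
Let pwg a : 0 < x `^ a. Proof. exact: powR_gt0. Qed.
Let pw1 a : 0 <= a -> 1 <= x `^ a. Proof. by move=> /pw; rewrite powRr0. Qed.
Let pwD a b : x `^ (a + b) = x `^ a * x `^ b. Proof. exact: powR_add. Qed.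
Let xpw : x = x `^ 1. Proof. by rewrite powRr1 // ltW. Qed.
Let xpwn k : x ^+ k = x `^ k%:R. Proof. by rewrite powR_mulrn // ltW. Qed.

(* Linear arithmetic on exponents, from the standing bounds on [eps] and [d0]. *)
Local Ltac elra := have := e0; have := ed; have := d00; have := d01; lra.

(** The factor [Lam] of the preceding parts. *)
Definition overlap_gain : R := x `^ d0.

Lemma overlap_gain_ge1 : 1 <= overlap_gain. Proof. exact/pw1/ltW. Qed.

Lemma overlap_gain_sq_le : overlap_gain ^+ 2 <= x ^+ 2 * p ^+ r.+1.
Proof.
apply: le_trans (_ : x ^+ 2 * (x `^ (- c)) ^+ r.+1 <= _); last first.
  rewrite ler_pM2l ?exprn_gt0 // lerXn2r ?nnegrE //; [exact: powR_ge0|exact: ltW].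
by rewrite /overlap_gain !powR_expn xpwn -pwD dc mulNr.
Qed.

Lemma t_le_half : t <= x `^ (1 / 2 + eps).
Proof. by apply: le_trans tu _; rewrite ger_pMr. Qed.

Lemma t_le_x : t <= x.
Proof. apply: le_trans t_le_half _; rewrite [leRHS]xpw; apply: pw; elra. Qed.

(** With this size t |B| / n is about n^(eps/2): large, so that the linear part
    decays, but so small that it is harmless in [error_scale_isolated]. *)
Definition block_target : R := x `^ (1 + eps / 2) / t.

Lemma t_block_target : t * block_target = x `^ (1 + eps / 2).
Proof. by rewrite /block_target mulrC divfK // gt_eqF. Qed.

Lemma block_target_lower : x `^ (eps / 2) <= block_target.
Proof.
rewrite /block_target ler_pdivlMr //; apply: le_trans (ler_wpM2l _ t_le_half) _; first exact/ltW.
by rewrite -pwD; apply: pw; elra.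
Qed.

Lemma block_target_upper : block_target <= x `^ (1 - eps / 2).
Proof.
rewrite /block_target ler_pdivrMr //; apply: le_trans (ler_wpM2l _ te); last exact/ltW.
by rewrite -pwD; apply: pw; elra.
Qed.

Lemma size_threshold_ge2 : 2 <= size_threshold.
Proof.
rewrite /size_threshold -addrA lerDl addr_ge0 //; first by rewrite mulr_ge0.
by rewrite !mulr_ge0 // ?invr_ge0 // sqrtr_ge0.
Qed.

Definition block_size := (Num.truncn block_target).+1.

Lemma block_size_lower : block_target <= block_size%:R.
Proof.
have y0 : 0 <= block_target by apply: le_trans block_target_lower; exact/ltW.
by have /andP[_ /ltW] := truncn_itv y0.
Qed.

Lemma block_size_upper : block_size%:R <= 2 * block_target.
Proof.
have y2 : 2 <= block_target by apply: le_trans block_target_lower; apply: le_trans size_threshold_ge2 xC0.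
have y0 : 0 <= block_target by apply: le_trans y2.
have /andP[h _] := truncn_itv y0.
by rewrite /block_size -natr1; lra.
Qed.

Lemma block_size_le_n : (block_size <= n)%N.
Proof.
have h : block_size%:R <= x.
  apply: le_trans block_size_upper _; apply: le_trans (_ : x `^ (eps / 2) * x `^ (1 - eps / 2) <= _).
    apply: ler_pM => //; [|exact: le_trans size_threshold_ge2 xC0|exact: block_target_upper].
    by apply: le_trans block_target_lower; exact/ltW.
  by rewrite -pwD [leRHS]xpw; apply: pw; elra.
by rewrite -(ler_nat R).
Qed.

Lemma x_t_block_target : x `^ (eps / 2) * x = t * block_target.
Proof. by rewrite t_block_target addrC pwD -xpw. Qed.

Lemma t_beta_lower : x `^ (eps / 2) <= t * block_size%:R / x.
Proof. by rewrite ler_pdivlMr // x_t_block_target ler_pM2l // block_size_lower. Qed.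

Lemma t_beta_upper : t * block_size%:R / x <= 2 * x `^ (eps / 2).
Proof. by rewrite ler_pdivrMr // -mulrA x_t_block_target mulrCA ler_pM2l // block_size_upper. Qed.

(** A bound for the typical size of s Q, up to a constant. It has to make both
    [error_scale_isolated] and [error_scale_shared] true, where [eps <= d0 / 8]
    leaves room to lose half of the exponent of the gain [n^d0]; the square root
    yields [d0 / 4], and the factor 3 covers the constant 8 = 2^3 from
    [t_beta_upper]. *)
Definition error_scale : R := 3 * x `^ (- d0 / 4).

Lemma error_scale_ge0 : 0 <= error_scale. Proof. by rewrite mulr_ge0 // ltW. Qed.

Lemma error_scale_sq : error_scale ^+ 2 = 9 * x `^ (- d0 / 2).
Proof.
rewrite /error_scale exprMn powR_expn (_ : 3 ^+ 2 = 9); last by ring.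
by congr (_ * x `^ _); elra.
Qed.

(** The left side is (t |B| / n)^3 / t, at most 8 n^(3 eps/2) / n^eps. *)
Lemma error_scale_isolated : t ^+ 2 * (block_size%:R / x) ^+ 3 <= error_scale ^+ 2 * overlap_gain.
Proof.
rewrite error_scale_sq /overlap_gain -mulrA -pwD.
have e1 : - d0 / 2 + d0 = d0 / 2 by elra.
rewrite e1 -(ler_pM2l t0).
have -> : t * (t ^+ 2 * (block_size%:R / x) ^+ 3) = (t * block_size%:R / x) ^+ 3.
  by rewrite -mulrA; move: (block_size%:R / x) => z; ring.
apply: le_trans (_ : (2 * x `^ (eps / 2)) ^+ 3 <= _).
  rewrite lerXn2r ?nnegrE ?t_beta_upper //.
    by rewrite divr_ge0 ?(ltW x0) // mulr_ge0 // ltW.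
  by rewrite mulr_ge0 // ltW.
rewrite exprMn powR_expn mulrCA (_ : 2 ^+ 3 = 8); last by ring.
apply: ler_pM => //; [exact/ltW| by rewrite ler_nat|].
apply: le_trans (_ : x `^ eps * x `^ (d0 / 2) <= _).
  by rewrite -pwD; apply: pw; elra.
by rewrite ler_pM2r.
Qed.

Lemma error_scale_shared : t ^+ 2 <= error_scale ^+ 2 * (x * overlap_gain).
Proof.
rewrite error_scale_sq /overlap_gain [x * _](_ : _ = x `^ (1 + d0)); last by rewrite pwD -xpw.
rewrite -mulrA -pwD.
apply: le_trans (_ : (x `^ (1 / 2 + eps)) ^+ 2 <= _).
  by rewrite lerXn2r ?nnegrE ?t_le_half // ltW.
rewrite powR_expn; apply: le_trans (_ : 1 * x `^ (- d0 / 2 + (1 + d0)) <= _).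
  by rewrite [leRHS]mul1r; apply: pw; elra.
by rewrite ler_pM2r // ler1n.
Qed.

Local Notation sig0 := (sd_scale n r p).
Local Notation mu0 := (coef_scale n r p).
Definition sd_lo : R := Num.sqrt cV.
Definition sd_hi : R := Num.sqrt Kv.
Local Notation sd := (clique_sd n r p).
Definition freq : R := t / sd.

Lemma var_const_gt0 : 0 < cV.
Proof.
rewrite /var_const mulr_gt0 // ?exprn_gt0 ?count_const_gt0 //.
by rewrite invr_gt0 mulr_gt0 // ltr0n bin_gt0.
Qed.

Lemma sd_lo_gt0 : 0 < sd_lo. Proof. by rewrite sqrtr_gt0 var_const_gt0. Qed.
Lemma sd_hi_gt0 : 0 < sd_hi. Proof. by rewrite sqrtr_gt0 moment_const_gt0. Qed.
Lemma sd_scale_pos : 0 < sig0. Proof. exact: sd_scale_gt0. Qed.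
Lemma sqrtp_pos : 0 < Num.sqrt p. Proof. by rewrite sqrtr_gt0. Qed.

Lemma sd_lower : sd_lo * sig0 <= sd.
Proof.
rewrite /clique_sd clique_varianceE -[sd_scale n r p]ger0_norm ?(ltW sd_scale_pos) // -sqrtr_sqr.
rewrite -sqrtrM ?(ltW var_const_gt0) //; apply: ler_wsqrtr.
exact: (var_lower p0 p1 overlap_gain_ge1 overlap_gain_sq_le n0 r1).
Qed.

Lemma sd_upper : sd <= sd_hi * sig0.
Proof.
rewrite /clique_sd clique_varianceE -[sd_scale n r p]ger0_norm ?(ltW sd_scale_pos) // -sqrtr_sqr.
rewrite -sqrtrM ?(ltW (moment_const_gt0 _ _ _)) //; apply: ler_wsqrtr.
exact: (var_upper p0 p1 overlap_gain_ge1 overlap_gain_sq_le n0 r1).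
Qed.

Lemma sd_gt0 : 0 < sd.
Proof. by apply: lt_le_trans sd_lower; rewrite mulr_gt0 ?sd_lo_gt0 ?sd_scale_pos. Qed.

Lemma freq_gt0 : 0 < freq. Proof. by rewrite divr_gt0 // sd_gt0. Qed.

Lemma freq_upper : freq * sig0 <= t / sd_lo.
Proof.
rewrite /freq mulrAC ler_pdivrMr ?sd_gt0 // mulrAC ler_pdivlMr ?sd_lo_gt0 //.
by rewrite -mulrA ler_pM2l // mulrC sd_lower.
Qed.

Lemma freq_lower : t / sd_hi <= freq * sig0.
Proof.
rewrite /freq mulrAC ler_pdivlMr ?sd_gt0 // mulrAC ler_pdivrMr ?sd_hi_gt0 //.
by rewrite -mulrA ler_pM2l // mulrC sd_upper.
Qed.

Lemma coef_scale_sd_scale : mu0 * (x * Num.sqrt p) = sig0.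
Proof.
rewrite /coef_scale /sd_scale -/x; move: (clique_mass n r p) => z.
have hp : p = Num.sqrt p * Num.sqrt p by rewrite -expr2 sqr_sqrtr // ltW.
have gx : x != 0 by rewrite gt_eqF.
have gq : Num.sqrt p != 0 by rewrite gt_eqF // sqrtp_pos.
rewrite [in X in _ / (x ^+ 2 * X)]hp.
by move: (Num.sqrt p) gq => q gq; field; rewrite gx gq.
Qed.

(** The phase is of order t / (n sqrt p), and t <= n^(1/2 + eps) p. *)
Lemma small_phase : freq * (3 / 2 * mu0) <= 1.
Proof.
have xq : 0 < x * Num.sqrt p by rewrite mulr_gt0 ?sqrtp_pos.
have E : freq * (3 / 2 * mu0) * (x * Num.sqrt p) = 3 / 2 * (freq * sig0).
  by rewrite -coef_scale_sd_scale; move: (Num.sqrt p) mu0 freq => u v w; field.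
rewrite -(ler_pM2r xq) E mul1r.
apply: le_trans (_ : 3 / 2 * (t / sd_lo) <= _).
  by rewrite ler_wpM2l ?freq_upper // divr_ge0.
rewrite [t / sd_lo]mulrC mulrA.
have h1 : 3 / 2 / sd_lo <= x `^ (eps / 2).
  apply: le_trans xC0; rewrite /size_threshold lerDr addr_ge0 //.
  by rewrite mulr_ge0.
have h2 : t <= x `^ (1 / 2 + eps) * Num.sqrt p.
  apply: le_trans tu _; rewrite ler_pM2l //.
  rewrite -[X in X <= _](sqr_sqrtr (ltW p0)) expr2 ger_pMr ?sqrtp_pos //.
  by rewrite -sqrtr1 ler_wsqrtr.
apply: le_trans (_ : x `^ (eps / 2) * (x `^ (1 / 2 + eps) * Num.sqrt p) <= _).
  apply: ler_pM => //; last exact/ltW.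
  by rewrite divr_ge0 ?(ltW sd_lo_gt0) // divr_ge0.
rewrite mulrA ler_pM2r ?sqrtp_pos // -pwD [leRHS]xpw; apply: pw; elra.
Qed.

Lemma sd_scale_ge1 : 1 <= sig0.
Proof.
have xq : 0 < x * Num.sqrt p by rewrite mulr_gt0 ?sqrtp_pos.
rewrite /sd_scale ler_pdivlMr // mul1r.
have h : x ^+ 2 * p <= clique_mass n r p.
  have := @clique_scale_gex2p R x p overlap_gain r p0 p1 overlap_gain_ge1 overlap_gain_sq_le x0 (ltnW r1) r.
  by rewrite r1 leqnn; apply.
apply: le_trans h; rewrite expr2 -mulrA ler_pM2l //.
have xp1 : 1 <= x * Num.sqrt p.
  apply: le_trans (_ : x * p <= _).
    exact: le_trans overlap_gain_ge1 (Lam_le_xp p0 p1 overlap_gain_ge1 overlap_gain_sq_le x0 (ltnW r1)).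
  rewrite ler_pM2l // -[X in X <= _](sqr_sqrtr (ltW p0)) expr2 ger_pMr ?sqrtp_pos //.
  by rewrite -sqrtr1 ler_wsqrtr.
rewrite -[X in _ <= _ * X](sqr_sqrtr (ltW p0)) expr2 mulrA.
by rewrite ler_peMl // ltW // sqrtp_pos.
Qed.

Lemma freq_le_n : freq <= x / sd_lo.
Proof.
apply: le_trans (_ : freq * sig0 <= _).
  by rewrite ler_peMr ?sd_scale_ge1 // ltW // freq_gt0.
apply: le_trans freq_upper _.
by rewrite ler_pM2r ?invr_gt0 ?sd_lo_gt0 // t_le_x.
Qed.

Lemma num_cliques_le : (num_cliques 'I_n r)%:R <= x ^+ r.
Proof.
have -> : num_cliques 'I_n r = 'C(n, r).
  rewrite /num_cliques -[X in 'C(X, r)]card_ord -cardsT -cards_draws.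
  by apply: eq_card => A; rewrite !inE subsetT.
rewrite -natrX ler_nat; apply: leq_trans (_ : 'C(n, r) * r`! <= _)%N.
  by rewrite leq_pmulr // fact_gt0.
by rewrite bin_ffact; exact: ffact_le.
Qed.

Lemma block_size_ge : size_threshold <= block_size%:R.
Proof. exact: le_trans xC0 (le_trans block_target_lower block_size_lower). Qed.

Lemma block_size_ge_nat : (2 + 8 * (L * Dr) <= block_size)%N.
Proof.
rewrite -(ler_nat R); apply: le_trans block_size_ge.
rewrite natrD natrM /size_threshold lerDl divr_ge0 ?sqrtr_ge0 // divr_ge0 //.
Qed.

Lemma many_edges : (block_size * block_size <= 8 * ('C(block_size, 2) - L * Dr))%N.
Proof. by have [] := bin2_room block_size_ge_nat. Qed.

Lemma enough_edges : (L * Dr <= 'C(block_size, 2))%N.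
Proof. by have [] := bin2_room block_size_ge_nat. Qed.

Variable B : {set 'I_n}.
Hypothesis cB : #|B| = block_size.

(** At least |B|^2 / 8 edges of the block remain, and each contributes
    p (s d_e)^2, of order (t / n)^2; the product is (t |B| / n)^2 up to a
    constant. *)
Lemma rate_lower :
  decay_const * x `^ eps <= rate p freq (cN * mu0 / 2) * (#|edges B| - L * Dr)%:R.
Proof.
rewrite card_edges cB.
have e8 : (block_size%:R * block_size%:R : R) / 8 <= ('C(block_size, 2) - L * Dr)%:R.
  rewrite ler_pdivrMr // -!natrM ler_nat mulnC; exact: many_edges.
apply: le_trans (_ : rate p freq (cN * mu0 / 2) * (block_size%:R * block_size%:R / 8) <= _); last first.
  by rewrite ler_wpM2l // rate_ge0.
have xq : 0 < x * Num.sqrt p by rewrite mulr_gt0 ?sqrtp_pos.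
have rE : rate p freq (cN * mu0 / 2) = cN ^+ 2 / 32 * ((freq * sig0) / x) ^+ 2.
  rewrite /rate -coef_scale_sd_scale.
  have hp : p = Num.sqrt p ^+ 2 by rewrite sqr_sqrtr // ltW.
  have gx : x != 0 by rewrite gt_eqF.
  move: mu0 freq cN => u v w; rewrite [X in X * _ / 8]hp.
  by move: (Num.sqrt p) => q; field; rewrite gx.
rewrite rE /decay_const.
have ts : (t / sd_hi) ^+ 2 <= (freq * sig0) ^+ 2.
  have ta0 : 0 <= t / sd_hi by rewrite divr_ge0 // ltW // sd_hi_gt0.
  by rewrite lerXn2r ?nnegrE ?freq_lower // (le_trans ta0) ?freq_lower.
have tb2 : x `^ eps <= (t * block_size%:R / x) ^+ 2.
  have -> : x `^ eps = (x `^ (eps / 2)) ^+ 2 by rewrite powR_expn divfK ?pnatr_eq0.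
  rewrite lerXn2r ?nnegrE ?t_beta_lower //; first exact/ltW.
  by rewrite divr_ge0 ?(ltW x0) // mulr_ge0 // ltW.
have a22 : sd_hi ^+ 2 = Kv by rewrite /sd_hi sqr_sqrtr // ltW // moment_const_gt0.
have Kv0 : 0 < Kv by exact: moment_const_gt0.
apply: le_trans (_ : cN ^+ 2 / (256 * Kv) * (t * block_size%:R / x) ^+ 2 <= _).
  by rewrite ler_wpM2l // divr_ge0 ?exprn_ge0 ?(ltW (count_const_gt0 _ _)) // mulr_ge0 // ltW.
have -> : cN ^+ 2 / (256 * Kv) * (t * block_size%:R / x) ^+ 2 =
   cN ^+ 2 / 256 * (block_size%:R / x) ^+ 2 * (t / sd_hi) ^+ 2.
  rewrite -a22; have gx : x != 0 by rewrite gt_eqF.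
  have ga : sd_hi != 0 by rewrite gt_eqF // sd_hi_gt0.
  by move: (block_size%:R : R) sd_hi ga cN t => bb u gu v w; field; rewrite gx gu.
have -> : cN ^+ 2 / 32 * (freq * sig0 / x) ^+ 2 * (block_size%:R * block_size%:R / 8) =
   cN ^+ 2 / 256 * (block_size%:R / x) ^+ 2 * (freq * sig0) ^+ 2.
  have gx : x != 0 by rewrite gt_eqF.
  by move: (block_size%:R : R) cN (freq * sig0) => bb v w; field; rewrite gx.
apply: ler_wpM2l => //.
by rewrite mulr_ge0 // ?exprn_even_ge0 // divr_ge0 // exprn_even_ge0.
Qed.

Lemma decay_const_gt0 : 0 < decay_const.
Proof. by rewrite divr_gt0 ?exprn_gt0 ?count_const_gt0 // mulr_gt0 ?moment_const_gt0. Qed.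

(** The exponential of a power of n is traded for the inverse power
    n^(- eps (m + 1)), which pays for the factor n^((r + 1) L) that bounds the
    polynomial prefactors. *)
Lemma expterm_upper : expterm r p B freq L <= decay_error * x `^ (- K - 1).
Proof.
set z := decay_const * x `^ eps.
have z0 : 0 < z by rewrite mulr_gt0 ?decay_const_gt0.
set Cb := 1 + quad_const R r / Num.sqrt cV.
have cq0 : 0 <= quad_const R r / Num.sqrt cV by rewrite divr_ge0 ?quad_const_ge0 ?sqrtr_ge0.
have Cb1 : 1 <= Cb by rewrite lerDl.
have base_le : freq * ((num_cliques 'I_n r)%:R * quad_const R r) <= Cb * x ^+ r.+1.
  apply: le_trans (_ : x / sd_lo * (x ^+ r * quad_const R r) <= _).
    apply: ler_pM; [exact/ltW/freq_gt0|by rewrite mulr_ge0 ?quad_const_ge0|exact: freq_le_n|].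
    by rewrite ler_wpM2r ?quad_const_ge0 ?num_cliques_le.
  have -> : x / sd_lo * (x ^+ r * quad_const R r) = quad_const R r / Num.sqrt cV * x ^+ r.+1.
    rewrite exprS /sd_lo; move: (Num.sqrt _)^-1 (quad_const R r) (x ^+ r) => u v w; ring.
  by rewrite ler_wpM2r ?exprn_ge0 // lerDr.
have b0 : 0 <= freq * ((num_cliques 'I_n r)%:R * quad_const R r).
  by rewrite mulr_ge0 ?(ltW freq_gt0) // mulr_ge0 ?quad_const_ge0.
have Cx1 : 1 <= Cb * x ^+ r.+1 by rewrite mulr_ege1 // exprn_ege1.
have ez : expR (- rate p freq (cN * mu0 / 2) * (#|edges B| - L * Dr)%:R) <=
   (m.+1`!)%:R / decay_const ^+ m.+1 * x `^ (- (eps * m.+1%:R)).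
  rewrite mulNr; apply: le_trans (_ : expR (- z) <= _).
    by rewrite ler_expR lerN2 rate_lower.
  apply: le_trans (expRN_poly m z0) _.
  by rewrite /z exprMn powR_expn powRN invfM mulrA.
rewrite /expterm.
apply: le_trans (_ : \sum_(j < L) 2 * (Cb * x ^+ r.+1) ^+ L *
   ((m.+1`!)%:R / decay_const ^+ m.+1 * x `^ (- (eps * m.+1%:R))) <= _).
  apply: ler_sum => j _; apply: ler_pM; rewrite ?expR_ge0 //.
    by rewrite mulr_ge0 // exprn_ge0.
  rewrite ler_pM2l //; apply: le_trans (_ : (Cb * x ^+ r.+1) ^+ j <= _).
    by rewrite lerXn2r ?nnegrE // (le_trans _ Cx1).
  by apply: ler_weXn2l => //; exact/ltnW.
rewrite sumr_const card_ord -[leLHS]mulr_natl exprMn.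
have xr : (x ^+ r.+1) ^+ L = x `^ (r.+1%:R * L%:R) by rewrite xpwn powR_expn.
rewrite xr /decay_error -/Cb.
have -> : L%:R * (2 * (Cb ^+ L * x `^ (r.+1%:R * L%:R)) *
   ((m.+1`!)%:R / decay_const ^+ m.+1 * x `^ (- (eps * m.+1%:R)))) =
   L%:R * (2 * Cb ^+ L) * ((m.+1`!)%:R / decay_const ^+ m.+1) *
   x `^ (r.+1%:R * L%:R - eps * m.+1%:R).
  rewrite pwD; move: (x `^ (- _)) => u1; move: (x `^ _) => u2; move: (_ / decay_const ^+ _) => u3.
  by move: (Cb ^+ L) => u4; ring.
apply: ler_wpM2l.
  rewrite mulr_ge0 // ?mulr_ge0 ?exprn_ge0 //; first by apply: le_trans Cb1.
  by rewrite invr_ge0 exprn_ge0 // ltW // decay_const_gt0.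
apply: pw; have := mK; move: (_ * _) (_ * _) => u v; have := K0; lra.
Qed.

(** The gain n^(- d0 L / 2) against the at most n^2 edges of the block. *)
Lemma dev_term_upper :
  #|edges B|%:R * (moment_const R r L * (2 / (cN * Num.sqrt overlap_gain)) ^+ L) <= coef_error * x `^ (- K - 1).
Proof.
have M2 : #|edges B|%:R <= x `^ 2.
  rewrite card_edges cB -xpwn -natrX ler_nat.
  apply: leq_trans (_ : 'C(block_size, 2) * 2`! <= _)%N; first by rewrite leq_pmulr.
  rewrite bin_ffact; apply: leq_trans (ffact_le _ _) _; apply: leq_pow; exact: block_size_le_n.
have sL : Num.sqrt overlap_gain = x `^ (d0 / 2).
  by rewrite /overlap_gain -powR12_sqrt ?powR_ge0 // -powRrM.
have -> : (2 / (cN * Num.sqrt overlap_gain)) ^+ L = (2 / cN) ^+ L * x `^ (- (d0 / 2 * L%:R)).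
  by rewrite sL invfM mulrA exprMn exprVn powR_expn powRN.
have E4 (z1 z2 z3 z4 : R) : z1 * (z2 * (z3 * z4)) = z2 * z3 * (z1 * z4) by ring.
rewrite E4 -/coef_error; apply: ler_wpM2l.
  by rewrite mulr_ge0 ?(ltW (moment_const_gt0 _ _ _)) // exprn_ge0 // divr_ge0 // ltW // count_const_gt0.
apply: le_trans (_ : x `^ 2 * x `^ (- (d0 / 2 * L%:R)) <= _); first by rewrite ler_pM2r.
rewrite -pwD; apply: pw.
have -> : d0 / 2 * L%:R = 2 * (d0 / 4 * L%:R) by move: (L%:R : R) => u; field.
have := LK; move: (_ * L%:R) => u; have := K0; lra.
Qed.

Lemma quad_term_upper :
  2 * (moment_const R r L * (freq * (sig0 * error_scale / t)) ^+ L) <= quad_error * x `^ (- K - 1).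
Proof.
have h : freq * (sig0 * error_scale / t) <= 3 / sd_lo * x `^ (- d0 / 4).
  have -> : freq * (sig0 * error_scale / t) = (freq * sig0) * (error_scale / t).
    by rewrite !mulrA.
  apply: le_trans (ler_wpM2r _ freq_upper) _; first by rewrite divr_ge0 ?error_scale_ge0 // ltW.
  rewrite /error_scale le_eqVlt; apply/orP; left; apply/eqP.
  have gt : t != 0 by rewrite gt_eqF.
  have ga : sd_lo != 0 by rewrite gt_eqF // sd_lo_gt0.
  by move: sd_lo ga (x `^ _) => u gu v; field; rewrite gt gu.
have h0 : 0 <= freq * (sig0 * error_scale / t).
  by rewrite mulr_ge0 ?(ltW freq_gt0) // divr_ge0 ?(ltW t0) // mulr_ge0 ?error_scale_ge0 // ltW // sd_scale_pos.
have E5 (z1 z2 z3 z4 : R) : z1 * (z2 * z3) * z4 = z1 * (z2 * (z3 * z4)) by ring.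
rewrite /quad_error E5 ler_pM2l // ler_pM2l ?moment_const_gt0 //.
apply: le_trans (_ : (3 / sd_lo * x `^ (- d0 / 4)) ^+ L <= _).
  by rewrite lerXn2r ?nnegrE // (le_trans h0).
rewrite exprMn -/sd_lo; apply: ler_wpM2l.
  by rewrite exprn_ge0 // divr_ge0 // ltW // sd_lo_gt0.
rewrite powR_expn; apply: pw.
have -> : - d0 / 4 * L%:R = - (d0 / 4 * L%:R) by rewrite !mulNr.
have := LK; move: (_ * L%:R) => u; lra.
Qed.

Lemma charfun_le_at_scale : cnorm (clique_charfun n r p t) <= t `^ (- K).
Proof.
rewrite clique_charfunE -/freq.
have bB : beta R B = block_size%:R / x by rewrite /beta cB.
have b1 : beta R B <= 1 by rewrite bB ler_pdivrMr // mul1r ler_nat block_size_le_n.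
have LM : (L * Dr <= #|edges B|)%N by rewrite card_edges cB enough_edges.
have := @charfun_bound R n r p overlap_gain p0 p2 overlap_gain_ge1 overlap_gain_sq_le n0 r1 rn B freq t error_scale L freq_gt0 t0 error_scale_ge0 b1 _ error_scale_shared oL LM small_phase.
rewrite bB => /(_ error_scale_isolated) bound; apply: le_trans bound _.
apply: le_trans (_ : (coef_error + decay_error + quad_error) * x `^ (- K - 1) <= _).
  rewrite [leRHS]mulrDl [in leRHS](mulrDl coef_error); apply: lerD; last exact: quad_term_upper.
  exact: lerD dev_term_upper expterm_upper.
apply: le_trans (ler_wpM2r _ xC) _; first exact/ltW.
rewrite [X in X * _]xpw -pwD addrC subrK.
by rewrite !powRN lef_pV2 ?posrE ?powR_gt0 // ge0_ler_powR ?nnegrE ?(ltW K0) ?(ltW t0) ?(ltW x0) // t_le_x.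
Qed.

End Scales.

(** From c < 3/(2r) one gets c (r + 1) / 2 < 3 (r + 1) / (4 r), which is at most
    1 exactly when r >= 3. *)
Lemma edge_exponent_gt0 (R : realType) (r : nat) (c : R) :
  (3 <= r)%N -> 0 < c -> c < 3 / (2 * r%:R) -> 0 < 1 - c * r.+1%:R / 2.
Proof.
move=> hr hc; rewrite ltr_pdivlMr ?mulr_gt0 ?ltr0n ?(ltn_trans _ hr) // => h.
have h3 : 3 <= r%:R :> R by rewrite ler_nat.
rewrite -natr1; move: (r%:R : R) h h3 => u h h3; nra.
Qed.

Unset Implicit Arguments.

Theorem lemma1p4 (R : realType) (r : nat) (c K : R)
    (hr : (3 <= r)%N) (hc : 0 < c) (hK : 0 < K) (hcr : c < 3 / (2 * r%:R)) :
  exists eps0 : R, 0 < eps0 /\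
    forall eps : R, 0 < eps -> eps < eps0 ->
      exists N : nat, forall n : nat, (N <= n)%N ->
        forall p : R, n%:R `^ (- c) <= p -> p <= 1 / 2 ->
          forall t : R, n%:R `^ eps <= t -> t <= n%:R `^ (1 / 2 + eps) * p ->
            `| clique_charfun n r p t | <= t `^ (- K).
Proof.
pose d0 : R := 1 - c * r.+1%:R / 2.
have d00 : 0 < d0 by exact: edge_exponent_gt0.
have d01 : d0 <= 1 by rewrite /d0 gerBl divr_ge0 // mulr_ge0 // ltW.
have dc : d0 * 2 = 2 - c * r.+1%:R by rewrite /d0; move: (c * _) => u; field.
exists (d0 / 8); split; first by rewrite divr_gt0.
move=> eps e0 /ltW ed.
have [l hl] := nat_above ((K + 3) / (d0 / 4)).
(* An even order with d0 L / 4 >= K + 3, for the two moment terms. *)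
pose L := (2 * l)%N.
have oL : ~~ odd L by rewrite /L mul2n odd_double.
have LK : K + 3 <= d0 / 4 * L%:R.
  rewrite mulrC -ler_pdivrMr ?divr_gt0 //; apply: le_trans hl _.
  by rewrite ler_nat /L leq_pmull.
(* The order at which the exponential is traded for a power. *)
have [m hm] := nat_above ((r.+1%:R * L%:R + K + 1) / eps).
have mK : r.+1%:R * L%:R + K + 1 <= eps * m.+1%:R.
  rewrite [leRHS]mulrC -ler_pdivrMr //; apply: le_trans hm _.
  by rewrite ler_nat.
have C00 : 0 <= size_threshold R r L.
  exact: le_trans (size_threshold_ge2 R r L).
have [N1 hN1] := powR_eventually (divr_gt0 e0 (ltr0n _ 2)) C00.
have [N2 hN2] := nat_above (coef_error R r L + decay_error R r L m + quad_error R r L).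
exists (maxn 1 (maxn (2 * r) (maxn N1 N2))) => n.
rewrite !geq_max => /andP[n0 /andP[rn /andP[nN1 nN2]]] p pc p2 t te tu.
have r1 : (1 < r)%N by exact: ltnW.
have xC : coef_error R r L + decay_error R r L m + quad_error R r L <= n%:R.
  by apply: le_trans hN2 _; rewrite ler_nat.
have bn := block_size_le_n n0 d00 d01 e0 ed (hN1 n nN1) p2 te tu.
have [B cB] : exists B : {set 'I_n}, #|B| = block_size n eps t.
  have /card_gt0P[B] : (0 < #|[set B : {set 'I_n} | (B \subset [set: 'I_n]) && (#|B| == block_size n eps t)]|)%N.
    by rewrite cards_draws cardsT card_ord bin_gt0.
  by rewrite inE => /andP[_ /eqP cB]; exists B.
exact: (charfun_le_at_scale n0 r1 rn hK d00 d01 e0 ed dc oL LK mK (hN1 n nN1) xC pc p2 te tu cB).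
Qed.
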